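(* Let $S$ be the split Dirac structure over a graph $G$ with fibre dimension $n$ (as defined in the context). Suppose that for every edge $e$ the elements $\gamma_e^\pm$ are Krein self-adjoint and odd, satisfy $J_{e^+}\gamma_e^+(J_{e^+})^{-1}=-h_e^+\gamma_e^-h_e^-$, and do not vanish identically on $S^L_{e^\pm}$ nor on $S^R_{e^\pm}$, and suppose that the discrete connection is metric, spin preserving and orientation preserving (so that $S$ is an antilorentzian spectral spacetime). Then: if $n=2$, $S$ is reconstructible. If $n>2$ and the discrete connection is Clifford, then $S$ is reconstructible if and only if there exists a future-directed timelike and parallel vector field on $G$.
   Context: **Krein adjoints.** For a space with a nondegenerate Hermitian form $(\cdot,\cdot)$ (Krein product), $A^\times$ denotes the adjoint: $(A^\times\phi,\psi)=(\phi,A\psi)$ for linear $A$, $(A^\times\phi,\psi)=\overline{(\phi,A\psi)}$ for antilinear $A$. A linear operator $A$ is Krein self-adjoint if $A^\times=A$, and Krein-positive if $(\cdot,A\,\cdot)$ is positive definite. **Time-orientation forms and reconstructibility.** For a structure $(\mathcal A,K,(\cdot,\cdot),\pi,D,J,\chi)$ with $\pi$ a representation of the algebra $\mathcal A$ on the Krein space $K$, $\Omega^1_D(\mathcal A,\pi)=\{\sum_i\pi(a_i)[D,\pi(b_i)]\ (\text{finite sums})\}$. A *positive time-orientation 1-form* is an element $\beta\in\Omega^1_D(\mathcal A,\pi)$ with $\beta^\times=\beta$, $J\beta J^{-1}=-\beta$, and $\langle\cdot,\cdot\rangle_\beta:=(\cdot,\beta^{-1}\cdot)$ positive definite. The structure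 is *reconstructible* if $\pi$ is faithful and there exists a positive time-orientation 1-form $\beta$ such that $\pi(\mathcal A)^{*_\beta}=\pi(\mathcal A)$, where $A^{*_\beta}=\beta A^\times\beta^{-1}$ is the adjoint for $\langle\cdot,\cdot\rangle_\beta$. **Split Dirac structure over $G$.** Data: - $G=(V,E,s,t,\delta)$ is a finite connected simple graph (no loops, at most one edge between two vertices) with at least one edge, with an orientation of its edges given by source/target maps $s,t:E\to V$, and positive weights $\delta_e>0$. Write $e^-=s(e)$, $e^+=t(e)$. - $n\ge2$ is even; for each $v\in V$, $X_v$ is an oriented real vector space of dimension $n$ with a bilinear form $g_v$ of antilorentzian signature $(1,n-1)$ (timelike means $g_v(x,x)>0$; Clifford relation $x^2=g_v(x,x)$). $\mathbb{C}l(X_v,g_v)$ is the complexified Clifford algebra, $c_v$ its real structure (antilinear automorphism fixing exactly the real Clifford algebra). - $S_v$ is an irreducible representation space of $\mathbb{C}l(X_v,g_v)\simeq\mathrm{End}(S_v)$, endowed with a $c_v$-compatible Krein product $(\cdot,\cdot)_v=(\cdot,\cdot)$, i.e. one for which elements of $X_v$ are Krein self-adjoint. A timelike $x\in X_v$ is *future-directed* if $(\cdot,x\,\cdot)_v$ is positive definite. $\chi_v$ is the chirality element (the multiple of the product of a positively oriented pseudo-orthonormal basis normalized so that $\chi_v^2=1$, with the same normalization at all vertices). $S_v^{L/R}$ are the $-1/+1$ eigenspaces of $\chi_v$; an element of $\mathrm{End}(S_v)$ is odd if it anticommutes with $\chi_v$. - $J_v$ is an antilinear operator on $S_v$ with $J_v^2=\epsilon$,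 $J_v\chi_v=\epsilon''\chi_vJ_v$, $J_vJ_v^\times=-1$, and $J_vxJ_v^{-1}=-x$ for all $x\in X_v$; here $(\epsilon,\epsilon'')=(-1,-1),(1,1),(1,-1),(-1,1)$ for $n\equiv0,2,4,6$ mod 8 respectively. - Discrete connection: for each edge $e$ a linear isomorphism $h_e^+:S_{e^-}\to S_{e^+}$, and $h_e^-:=(h_e^+)^{-1}$. For each edge, $\gamma_e^\pm\in\mathrm{End}(S_{e^\pm})$. Then $S=(\mathcal A^0,K,(\cdot,\cdot),\pi,D,J,\chi)$, where $\mathcal A^0$ is the algebra of sections $a:v\mapsto a(v)\in\mathbb{C}l(X_v,g_v)^0$ (even part); $K$ is the space of sections $F:(e,\pm)\mapsto F(e,\pm)\in S_{e^\pm}$ over $E\times\{-,+\}$; $(\pi(a)F)(e,\pm)=a(e^\pm)F(e,\pm)$; $$(F,G)=\sum_{e\in E}\big((F(e,+),h_e^+G(e,-))+(F(e,-),h_e^-G(e,+))\big),$$ $$(DF)(e,\pm)=\frac{\mp1}{\delta_e}\gamma_e^\pm h_e^\pm F(e,\mp),\quad(\chi F)(e,\pm)=\chi_{e^\pm}F(e,\pm),\quad(JF)(e,\pm)=h_e^\pm J_{e^\mp}F(e,\mp).$$ **Properties of the discrete connection.** *Metric*: every $h_e^+$ is Krein-unitary, i.e. $(h_e^+\psi,h_e^+\psi)=(\psi,\psi)$. *Spin preserving*: $h_e^\pm J_{e^\mp}=J_{e^\pm}h_e^\pm$ for all $e$. *Orientation preserving*: $\chi_{e^\pm}h_e^\pm=h_e^\pm\chi_{e^\mp}$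 for all $e$. *Clifford*: for every edge $e$ there is a linear map $\Lambda:X_{e^-}\to X_{e^+}$ with $h_e^+\,x=\Lambda(x)\,h_e^+$ (as operators $S_{e^-}\to S_{e^+}$) for all $x\in X_{e^-}$. **Parallel vector fields.** For a path $\mathcal Q=(x_1,\dots,x_k)$ of successively adjacent vertices, $h_{\mathcal Q}:S_{x_1}\to S_{x_k}$ is the composition, along the path, of the operators $h_{e_i}^{\sigma_i}$, where $e_i$ is the edge joining $x_i$ and $x_{i+1}$ and $\sigma_i=+$ if $e_i$ goes from $x_i$ to $x_{i+1}$, $\sigma_i=-$ otherwise; $H_{\mathcal Q}(a)=h_{\mathcal Q}\,a\,h_{\mathcal Q}^{-1}$. A vector field on $G$ is a section $v\mapsto u_v\in X_v$; it is *parallel* (covariantly constant) if $u_w=H_{\mathcal Q}(u_v)$ for all vertices $v,w$ and all paths $\mathcal Q$ from $v$ to $w$. It is future-directed timelike if each $u_v$ is. *)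

(* Defs.v *)
From HB Require Import structures.
From mathcomp Require Import all_boot all_order all_algebra.
From mathcomp Require Import sesquilinear.
From mathcomp Require Import boolp reals complex.

Set Implicit Arguments.
Unset Strict Implicit.
Unset Printing Implicit Defensive.

Import Order.TTheory GRing.Theory Num.Theory.
Local Open Scope ring_scope.
Local Open Scope complex_scope.

Section Sections.
Variables (K : nzRingType) (I : Type) (T : I -> lmodType K).

Definition sections : Type := forall i, T i.

HB.instance Definition _ := gen_eqMixin sections.
HB.instance Definition _ := gen_choiceMixin sections.

Definition sec_zero : sections := fun i => 0.
Definition sec_opp (f : sections) : sections := fun i => - f i.
Definition sec_add (f g : sections) : sections := fun i => f i + g i.
Definition sec_scale (k : K) (f : sections) : sections := fun i => k *: f i.

Fact sec_addA : associative sec_add.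
Proof. by move=> f g h; apply: functional_extensionality_dep => i; exact: addrA. Qed.
Fact sec_addC : commutative sec_add.
Proof. by move=> f g; apply: functional_extensionality_dep => i; exact: addrC. Qed.
Fact sec_add0 : left_id sec_zero sec_add.
Proof. by move=> f; apply: functional_extensionality_dep => i; exact: add0r. Qed.
Fact sec_addN : left_inverse sec_zero sec_opp sec_add.
Proof. by move=> f; apply: functional_extensionality_dep => i; exact: addNr. Qed.

HB.instance Definition _ := GRing.isZmodule.Build sections
  sec_addA sec_addC sec_add0 sec_addN.

Fact sec_scaleA a b (f : sections) :
  sec_scale a (sec_scale b f) = sec_scale (a * b) f.
Proof. by apply: functional_extensionality_dep => i; exact: scalerA. Qed.
Fact sec_scale1 : left_id 1 sec_scale.
Proof. by move=> f; apply: functional_extensionality_dep => i; exact: scale1r. Qed.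
Fact sec_scaleDr : right_distributive sec_scale +%R.
Proof. by move=> a f g; apply: functional_extensionality_dep => i; exact: scalerDr. Qed.
Fact sec_scaleDl (f : sections) : {morph sec_scale^~ f : a b / a + b}.
Proof. by move=> a b; apply: functional_extensionality_dep => i; exact: scalerDl. Qed.

HB.instance Definition _ := GRing.Zmodule_isLmodule.Build K sections
  sec_scaleA sec_scale1 sec_scaleDr sec_scaleDl.

End Sections.

(* Krein products. As in the sesquilinear library, a Hermitian form is linear *)
(* in its first argument and conjugate-linear in the second; no notion below  *)
(* depends on that choice.                                                    *)

Section Krein.
Variables (R : realType) (K : lmodType R[i]) (form : K -> K -> R[i]).

(* B is the adjoint of the linear operator A *)
Definition adjoint_of (A B : K -> K) :=
  forall phi psi, form (B phi) psi = form phi (A psi).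

(* B is the adjoint of the antilinear operator A *)
Definition antiadjoint_of (A B : K -> K) :=
  forall phi psi, form (B phi) psi = (form phi (A psi))^*.

Definition krein_selfadjoint (A : K -> K) := adjoint_of A A.

(* In R[i], 0 < z means that z is real and positive. *)
Definition krein_positive (A : K -> K) :=
  forall phi, phi != 0 -> 0 < form phi (A phi).

End Krein.

(* For a bijective J this is the equality J A J^-1 = B. *)
Definition conjugates_to (S S' : Type) (J : S -> S') (A : S -> S) (B : S' -> S') :=
  forall psi, J (A psi) = B (J psi).

Record krein_structure (R : realType) := KreinStructure {
  ks_alg : Type;
  ks_space : lmodType R[i];
  ks_form : ks_space -> ks_space -> R[i];
  ks_rep : ks_alg -> ks_space -> ks_space;
  ks_dirac : ks_space -> ks_space;
  ks_real : ks_space -> ks_space;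
  ks_chi : ks_space -> ks_space
}.

Section Reconstructible.
Variables (R : realType) (S : krein_structure R).
Let K := ks_space S.
Let form := @ks_form R S.
Let rep := @ks_rep R S.
Let D := @ks_dirac R S.
Let J := @ks_real R S.

Definition one_form (beta : K -> K) :=
  exists s : seq (ks_alg S * ks_alg S), forall F : K,
    beta F = \sum_(ab <- s) rep ab.1 (D (rep ab.2 F) - rep ab.2 (D F)).

Definition positive_time_orientation (beta betaV : K -> K) :=
  [/\ one_form beta,
      krein_selfadjoint form beta,
      conjugates_to J beta (fun F => - beta F),
      cancel beta betaV /\ cancel betaV beta
    & krein_positive form betaV].

(* Equality of the sets {beta rep(a)^x beta^-1} and {rep(b)}. *)
Definition star_stable (beta betaV : K -> K) :=
  (forall a, exists aX b, adjoint_of form (rep a) aX /\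
     forall F, beta (aX (betaV F)) = rep b F) /\
  (forall b, exists a aX, adjoint_of form (rep a) aX /\
     forall F, beta (aX (betaV F)) = rep b F).

Definition reconstructible :=
  (forall a b, (forall F, rep a F = rep b F) -> a = b) /\
  exists beta betaV,
    positive_time_orientation beta betaV /\ star_stable beta betaV.

End Reconstructible.

Section Clifford.
Variables (R : realType) (X : vectType R) (g : {symmetric X}).

Section Words.
Variables (A : algType R[i]) (iota : X -> A).

Definition word_sum (s : seq (R[i] * seq X)) : A :=
  \sum_(w <- s) w.1 *: \prod_(x <- w.2) iota x.

Definition clifford_even (a : A) :=
  exists2 s, all (fun w => ~~ odd (size w.2)) s & a = word_sum s.

Definition clifford_relation := forall x, iota x * iota x = (g x x)%:C%:A.

End Words.

(* The complex algebra generated by X subject to x^2 = g(x,x); that the       *)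
(* extension F is unique follows from the second clause.                      *)
Definition is_clifford_algebra (A : algType R[i])
    (iota : {linear X -> A | real_complex R \; *:%R}) :=
  [/\ clifford_relation iota,
      forall a : A, exists s, a = word_sum iota s
    & forall (B : algType R[i])
             (f : {linear X -> B | real_complex R \; *:%R}),
        clifford_relation f ->
        exists F : {lrmorphism A -> B}, forall x, F (iota x) = f x].

(* pseudo-orthonormal basis of a form of signature (1,n-1), timelike vector   *)
(* first                                                                      *)
Definition pseudo_orthonormal (n : nat) (b : n.-tuple X) :=
  basis_of fullv b /\
  forall i j : 'I_n, g (tnth b i) (tnth b j) =
    if i != j then 0 else if val i == 0%N then 1 else -1.

Definition antilorentzian (n : nat) := exists b : n.-tuple X, pseudo_orthonormal b.

(* An orientation is given by a reference basis o. *)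
Definition positively_oriented (n : nat) (o b : n.-tuple X) :=
  0 < \det (\matrix_(i < n, j < n) coord o j (tnth b i)).

End Clifford.

Definition sgn_eps (R : realType) (n : nat) : R[i] :=
  if (n %% 8)%N \in [:: 0; 6]%N then -1 else 1.
Definition sgn_eps'' (R : realType) (n : nat) : R[i] :=
  if (n %% 8)%N \in [:: 0; 4]%N then -1 else 1.

(* kappa is the normalization constant of the chirality element. *)
Record spinor_fibre (R : realType) (n : nat) (kappa : R[i]) := SpinorFibre {
  fX : vectType R;
  fg : {symmetric fX};
  fg_sig : antilorentzian fg n;
  forient : n.-tuple fX;
  forient_basis : basis_of fullv forient;

  fCl : algType R[i];
  fiota : {linear fX -> fCl | real_complex R \; *:%R};
  fCl_clifford : is_clifford_algebra fg fiota;

  fS : vectType R[i];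
  frho : {linear fCl -> 'End(fS)};
  frho1 : frho 1 = \1%VF;
  frhoM : forall a b, frho (a * b) = (frho a \o frho b)%VF;
  fS_neq0 : exists psi : fS, psi != 0;
  fS_irr : forall U : {vspace fS},
    (forall a psi, psi \in U -> frho a psi \in U) -> U = 0%VS \/ U = fullv;

  fform : {hermitian_sym fS for conjc};
  fform_nondeg : nondegenerate fform;
  fform_compat : forall x, krein_selfadjoint fform (frho (fiota x));

  fchi : fCl;
  fchi_def : forall b, pseudo_orthonormal fg b -> positively_oriented forient b ->
    fchi = kappa *: \prod_(x <- b) fiota x;
  fchi_sqr : fchi * fchi = 1;

  fJ : {linear fS -> fS | conjc \; *:%R};
  fJ_sqr : forall psi, fJ (fJ psi) = sgn_eps R n *: psi;
  fJ_chi : forall psi, fJ (frho fchi psi) = sgn_eps'' R n *: frho fchi (fJ psi);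
  fJ_anti : exists JX, antiadjoint_of fform fJ JX /\
    forall psi, fJ (JX psi) = - psi;
  fJ_vec : forall x,
    conjugates_to fJ (frho (fiota x)) (fun psi => - frho (fiota x) psi)
}.

Section Fibre.
Variables (R : realType) (n : nat) (kappa : R[i]) (Y : spinor_fibre n kappa).

Definition timelike (x : fX Y) := 0 < fg Y x x.

Definition future_directed (x : fX Y) :=
  timelike x /\ krein_positive (fform Y) (frho Y (fiota Y x)).

Definition left_spinor (psi : fS Y) := frho Y (fchi Y) psi = - psi.
Definition right_spinor (psi : fS Y) := frho Y (fchi Y) psi = psi.

Definition odd_operator (A : 'End(fS Y)) :=
  forall psi, A (frho Y (fchi Y) psi) = - frho Y (fchi Y) (A psi).

End Fibre.

(* The elements (e,-) and (e,+) of E x {-,+} are encoded as (e,false) and     *)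
(* (e,true).                                                                  *)

Section Darts.
Variables (V E : finType) (s t : E -> V).

Definition dart : Type := (E * bool)%type.

Definition endpoint (p : dart) : V := let: (e, b) := p in if b then t e else s e.

Definition opp_dart (p : dart) : dart := let: (e, b) := p in (e, ~~ b).

Definition adjacent : rel V := fun v w =>
  [exists e, ((s e == v) && (t e == w)) || ((s e == w) && (t e == v))].

Definition simple_connected_graph :=
  [/\ forall e, s e != t e,
      forall e f, [set s e; t e] = [set s f; t f] -> e = f,
      forall v w, connect adjacent v w
    & (0 < #|E|)%N].

End Darts.

Record split_data (R : realType) (n : nat) := SplitData {
  sV : finType;
  sE : finType;
  ssrc : sE -> sV;
  stgt : sE -> sV;
  sgraph : simple_connected_graph ssrc stgt;
  sdelta : sE -> R;
  sdelta_gt0 : forall e, 0 < sdelta e;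
  skappa : R[i];
  sfib : sV -> spinor_fibre n skappa;
  sh : forall e, 'Hom(fS (sfib (ssrc e)), fS (sfib (stgt e)));
  sh_inj : forall e, lker (sh e) = 0%VS;
  sh_surj : forall e, limg (sh e) = fullv;
  sgamma : forall p, 'End(fS (sfib (endpoint ssrc stgt p)))
}.

Section SplitDirac.
Variables (R : realType) (n : nat) (G : split_data R n).

Local Notation V := (sV G).
Local Notation E := (sE G).
Local Notation X v := (fX (sfib v)).
Local Notation S v := (fS (sfib v)).
Local Notation ept := (endpoint (@ssrc _ _ G) (@stgt _ _ G)).
Local Notation form v := (fform (sfib v)).
Local Notation J v := (fJ (sfib v)).
Local Notation chi v := (frho (sfib v) (fchi (sfib v))).

Definition vec (v : V) (x : X v) : 'End(S v) := frho (sfib v) (fiota (sfib v) x).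

(* h_e^+ at (e,+) and h_e^- = (h_e^+)^-1 at (e,-) *)
Definition hpm (p : dart E) : 'Hom(S (ept (opp_dart p)), S (ept p)) :=
  match p return 'Hom(S (ept (opp_dart p)), S (ept p)) with
  | (e, true) => sh e
  | (e, false) => (sh e)^-1%VF
  end.

Definition gammap (e : E) : 'End(S (stgt e)) := sgamma (e, true).
Definition gammam (e : E) : 'End(S (ssrc e)) := sgamma (e, false).

(* the carrier of the algebra of even sections; reconstructibility only sees  *)
(* its image under the representation *)
Definition even_sections : Type :=
  {a : forall v : V, fCl (sfib v) | forall v, clifford_even (fiota (sfib v)) (a v)}.

Definition split_space : Type := @sections R[i] (dart E) (fun p => S (ept p)).

HB.instance Definition _ := GRing.Lmodule.on split_space.

Definition split_form (F F' : split_space) : R[i] :=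
  \sum_(e : E) (form (stgt e) (F (e, true)) (hpm (e, true) (F' (e, false)))
              + form (ssrc e) (F (e, false)) (hpm (e, false) (F' (e, true)))).

Definition split_rep (a : even_sections) (F : split_space) : split_space :=
  fun p => frho (sfib (ept p)) (sval a (ept p)) (F p).

Definition split_dirac_op (F : split_space) : split_space :=
  fun p => ((if p.2 then -1 else 1) / sdelta p.1)%:C
             *: sgamma p (hpm p (F (opp_dart p))).

Definition split_J (F : split_space) : split_space :=
  fun p => hpm p (J (ept (opp_dart p)) (F (opp_dart p))).

Definition split_chi (F : split_space) : split_space :=
  fun p => chi (ept p) (F p).

Definition split_dirac : krein_structure R :=
  @KreinStructure R even_sections split_space split_form split_rep
    split_dirac_op split_J split_chi.

Definition gamma_selfadjoint :=
  forall p : dart E, krein_selfadjoint (form (ept p)) (sgamma p).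

Definition gamma_odd := forall p : dart E, odd_operator (sgamma p).

Definition gamma_J := forall e : E,
  conjugates_to (J (stgt e)) (gammap e)
    (fun psi => - hpm (e, true) (gammam e (hpm (e, false) psi))).

Definition gamma_nonvanishing := forall p : dart E,
  (exists2 psi, left_spinor psi & sgamma p psi != 0) /\
  (exists2 psi, right_spinor psi & sgamma p psi != 0).

Definition metric := forall (e : E) psi,
  form (stgt e) (sh e psi) (sh e psi) = form (ssrc e) psi psi.

Definition spin_preserving := forall (p : dart E) psi,
  hpm p (J (ept (opp_dart p)) psi) = J (ept p) (hpm p psi).

Definition orientation_preserving := forall (p : dart E) psi,
  chi (ept p) (hpm p psi) = hpm p (chi (ept (opp_dart p)) psi).

Definition clifford_connection := forall e : E,
  exists Lambda : {linear X (ssrc e) -> X (stgt e)},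
    forall x, (sh e \o vec x)%VF = (vec (Lambda x) \o sh e)%VF.

(* The graph being simple, a sequence of successively adjacent vertices       *)
(* amounts to a sequence of consecutive darts; the dart (e,+) goes from e^-   *)
(* to e^+, the dart (e,-) from e^+ to e^-, and hpm transports along it.       *)
Inductive walk : V -> V -> Type :=
| walk_nil v : walk v v
| walk_cons p w : walk (ept p) w -> walk (ept (opp_dart p)) w.

Fixpoint holonomy v w (Q : walk v w) : 'Hom(S v, S w) :=
  match Q in walk v w return 'Hom(S v, S w) with
  | walk_nil v => \1%VF
  | walk_cons p w Q' => (holonomy Q' \o hpm p)%VF
  end.

Definition parallel (u : forall v : V, X v) :=
  forall v w (Q : walk v w),
    vec (u w) = (holonomy Q \o vec (u v) \o (holonomy Q)^-1)%VF.

End SplitDirac.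

(* Main.v *)
From HB Require Import structures.
From mathcomp Require Import all_boot all_order all_algebra.
From mathcomp Require Import sesquilinear spectral.
From mathcomp Require Import boolp reals complex.
From mathcomp Require Import ring lra.
Require Import Defs.

Set Implicit Arguments.
Unset Strict Implicit.
Unset Printing Implicit Defensive.

Import Order.TTheory GRing.Theory Num.Theory.
Local Open Scope ring_scope.
Local Open Scope complex_scope.

(** For a dart p write p' for the opposite dart and h_p for the transport from
    the endpoint of p' to the endpoint of p.

    The operators that commute with the chirality are exactly the even Clifford
    elements (chiC_even, from Burnside's theorem), and an odd operator that
    vanishes on neither chirality generates all odd operators as a bimodule over
    them (odd_bimodule).  Hence the one-forms are exactly the operators
      (beta F)(p) = B_p h_p F(p'),   B_p odd,
    with arbitrary blocks B_p (one_form_blocks, one_form_of_blocks).  On blocks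
    the conditions read as follows.  The form beta is Krein self-adjoint and
    positive if and only if every B_p is.  Anticommutation with J says that J
    carries h_p B_p' h_p^-1 to - B_p.  Stability of the algebra under the adjoint
    of beta says that a -> B_p a B_p^-1, for a even, depends only on the endpoint
    of p; so two blocks at the same vertex differ by a factor l + m chi
    (block_at_ratio, from even_commutant).

    If u is a parallel future-directed field, then B_p = u at the endpoint of p
    satisfies all this.  If n = 2 the even algebra is commutative and the last
    condition is void: take any future-directed vector at the target of every
    edge and its transport at the source.  Both cases are instances of
    reconstructible_of_vectors.

    Conversely, blocks need not be vectors when n > 2.  For a chirality s with
    projection P_s, the real linear form x -> Re tr(B_p P_s x) on X is
    represented by a vector, the vector part of B_p P_s, which is timelike and
    future-directed (axis_future); this is where n > 2 is used.  A factor
    l + m chi acts on each chirality as a positive scalar, so the two unit vectors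
    obtained in this way depend only on the vertex.  A Clifford connection
    transports the vector part, and J preserves or exchanges the chiralities, so
    along an edge the two unit vectors are transported up to their order.  Their
    sum is the parallel field (parallel_future_vector).

    The tool behind all of this is an averaging argument: the mean of an operator
    T over the conjugations by the vectors of a pseudo-orthonormal basis commutes
    with the Clifford action and has the trace of T, so it is the scalar
    tr T / dim S (conj_avg_scalar).  It yields Burnside's theorem, the
    definiteness of the forms of timelike vectors (time_definite), the positivity
    of traces (trace_semipos) and their behaviour under J (J_trace). *)

(** * Traces, rank one operators and Schur's lemma *)

Section Trace.
Variable F : fieldType.

Lemma linear_linfunE (U W : vectType F) (f : U -> W) : linear f -> linfun f =1 f.
Proof.
move=> h; pose L : {linear U -> W} := HB.pack f (GRing.isLinear.Build _ _ _ _ _ h).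
exact: (lfunE L).
Qed.

Definition lftrace (U : vectType F) (f : 'End(U)) : F :=
  \tr (passmx.mxof (vbasis fullv) (vbasis fullv) f).

Lemma lftraceZD (U : vectType F) a (f g : 'End(U)) :
  lftrace (a *: f + g) = a * lftrace f + lftrace g.
Proof. by rewrite /lftrace passmx.mxof_linear raddfD /= mxtraceZ. Qed.

Lemma lftraceD (U : vectType F) (f g : 'End(U)) :
  lftrace (f + g) = lftrace f + lftrace g.
Proof. by rewrite -[f]scale1r lftraceZD mul1r scale1r. Qed.

Lemma lftraceZ (U : vectType F) a (f : 'End(U)) :
  lftrace (a *: f) = a * lftrace f.
Proof.
have t0 : lftrace (0 : 'End(U)) = 0.
  by apply: (addrI (lftrace (0 : 'End(U)))); rewrite -lftraceD !addr0.
by rewrite -[a *: f]addr0 lftraceZD t0 addr0.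
Qed.

Lemma lftraceC (U W : vectType F) (f : 'Hom(U, W)) (g : 'Hom(W, U)) :
  lftrace (f \o g)%VF = lftrace (g \o f)%VF.
Proof.
rewrite /lftrace.
rewrite (passmx.mxof_comp _ _ (vbasisP {:W})) mxtrace_mulC.
by rewrite -(passmx.mxof_comp _ _ (vbasisP {:U})).
Qed.

Lemma lftrace1 (U : vectType F) : lftrace (\1 : 'End(U))%VF = (\dim {:U})%:R.
Proof.
rewrite /lftrace passmx.mxof1 ?mxtrace1 //.
exact: basis_free (vbasisP _).
Qed.

Definition rank1 (U W : vectType F) (phi : 'Hom(U, F^o)) (alpha : W) : 'Hom(U, W) :=
  (linfun (fun c : F^o => (c : F) *: alpha) \o phi)%VF.

Lemma rank1E (U W : vectType F) (phi : 'Hom(U, F^o)) (alpha : W) psi :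
  rank1 phi alpha psi = (phi psi : F) *: alpha.
Proof.
rewrite comp_lfunE linear_linfunE // => a x y.
by rewrite scalerDl -scalerA.
Qed.

Lemma rank1_compE (U U' W : vectType F) (phi : 'Hom(U', F^o)) (alpha : W)
    (h : 'Hom(U, U')) psi :
  (rank1 phi alpha \o h)%VF psi = (phi (h psi) : F) *: alpha.
Proof. by rewrite comp_lfunE rank1E. Qed.

Lemma lftrace_rank1 (U : vectType F) (phi : 'Hom(U, F^o)) (alpha : U) :
  lftrace (rank1 phi alpha) = phi alpha.
Proof.
rewrite {2}(coord_basis (vbasisP {:U}) (memvf alpha)) linear_sum.
apply: eq_bigr => i _; rewrite !mxE /= passmx.vecof_delta rank1E.
by rewrite !linearZ /= mulrC.
Qed.

End Trace.

(** An eigenspace of T is stable under every operator that commutes with T. *)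
Lemma schur (C : numClosedFieldType) (U : vectType C) (P : 'End(U) -> Prop) :
    (exists psi : U, psi != 0) ->
    (forall W : {vspace U}, (forall f, P f -> forall psi, psi \in W -> f psi \in W) ->
      W = 0%VS \/ W = fullv) ->
  forall T : 'End(U), (forall f, P f -> forall psi, f (T psi) = T (f psi)) ->
  exists c, forall psi, T psi = c *: psi.
Proof.
move=> [psi0 psi0N] irr T commT.
have d0 : (0 < \dim {:U})%N.
  by rewrite lt0n dimv_eq0; apply: contra psi0N => /eqP U0; rewrite -memv0 -U0 memvf.
have [c /eqP ceig] :=
  eigenvalue_closed (passmx.mxof (vbasis fullv) (vbasis fullv) T) d0.
exists c.
have [|W0|Wf] := irr (passmx.leigenspace T c).
- move=> f Pf psi; rewrite !memv_ker !lfun_simp /= !subr_eq0 => /eqP e.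
  by rewrite -commT // e linearZ.
- exfalso; apply: ceig; move: W0.
  rewrite (passmx.leigenspaceE (vbasisP _)) => /eqP.
  by rewrite passmx.vsof_eq0 ?vbasisP // => /eqP.
- move=> psi; have : psi \in passmx.leigenspace T c by rewrite Wf memvf.
  by rewrite memv_ker !lfun_simp /= subr_eq0 => /eqP.
Qed.

(** * The Clifford action on a spinor space *)

Section FibreTheory.
Variables (R : realType) (n : nat) (kappa : R[i]) (Y : spinor_fibre n kappa).

Local Notation X := (fX Y).
Local Notation S := (fS Y).
Local Notation g := (fg Y).
Local Notation rho := (frho Y).
Local Notation "''[' x , y ]" := (fform Y x y).
Local Notation "x ^^*" := (@conjc R x) (at level 2, left associativity, format "x ^^*").

Implicit Types (x y z u : X) (phi psi th : S).

Definition vec_op (x : X) : 'End(S) := rho (fiota Y x).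

Local Notation v := vec_op.

Lemma metricC x y : g x y = g y x.
Proof. by rewrite hermC expr0 mul1r. Qed.
Lemma metricDl x y z : g (x + y) z = g x z + g y z. Proof. exact: linearDl. Qed.
Lemma metricDr x y z : g x (y + z) = g x y + g x z. Proof. exact: linearDr. Qed.
Lemma metricZl (a : R) x y : g (a *: x) y = a * g x y.
Proof. by rewrite linearZl_LR. Qed.
Lemma metricZr (a : R) x y : g x (a *: y) = a * g x y.
Proof. by rewrite metricC metricZl metricC. Qed.

Lemma formC phi psi : '[phi, psi] = '[psi, phi]^^*.
Proof. by rewrite hermC expr0 mul1r. Qed.
Lemma formDl phi psi th : '[phi + psi, th] = '[phi, th] + '[psi, th].
Proof. exact: linearDl. Qed.
Lemma formDr phi psi th : '[phi, psi + th] = '[phi, psi] + '[phi, th].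
Proof. exact: linearDr. Qed.
Lemma formZl (c : R[i]) phi psi : '[c *: phi, psi] = c * '[phi, psi].
Proof. by rewrite linearZl_LR. Qed.
Lemma formZr (c : R[i]) phi psi : '[phi, c *: psi] = c^^* * '[phi, psi].
Proof. by rewrite formC formZl rmorphM /= -formC. Qed.
Lemma formNl phi psi : '[- phi, psi] = - '[phi, psi].
Proof. by rewrite -scaleN1r formZl mulN1r. Qed.
Lemma formNr phi psi : '[phi, - psi] = - '[phi, psi].
Proof. by rewrite formC formNl rmorphN /= -formC. Qed.
Lemma form0l psi : '[0, psi] = 0.
Proof. by rewrite -[0](scale0r 0) formZl mul0r. Qed.
Lemma form0r psi : '[psi, 0] = 0.
Proof. by rewrite formC form0l conjc0. Qed.

Lemma form_nondeg phi : phi != 0 -> exists psi, '[phi, psi] != 0.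
Proof.
move=> phi0; move: (fform_nondeg Y) => /eqP nd.
have : phi \notin orthov (fform Y) fullv by rewrite nd memv0.
by case/mem_orthovPn => psi _ h; exists psi.
Qed.

Lemma form_eqP phi phi' : (forall psi, '[phi, psi] = '[phi', psi]) -> phi = phi'.
Proof.
move=> h; apply/eqP; rewrite -subr_eq0; apply/negPn/negP => /form_nondeg[psi].
by rewrite formDl formNl h subrr eqxx.
Qed.

Lemma vecD x y : v (x + y) = v x + v y.
Proof. by rewrite /vec_op !linearD. Qed.
Lemma vecZ (a : R) x : v (a *: x) = a%:C *: v x.
Proof. by rewrite /vec_op linearZ_LR /= linearZ_LR. Qed.

Lemma rho0 psi : rho 0 psi = 0.
Proof. by rewrite linear0 zero_lfunE. Qed.
Lemma rhoD a b psi : rho (a + b) psi = rho a psi + rho b psi.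
Proof. by rewrite linearD add_lfunE. Qed.
Lemma rhoZ (c : R[i]) a psi : rho (c *: a) psi = c *: rho a psi.
Proof. by rewrite linearZ_LR scale_lfunE. Qed.
Lemma rhoM a b psi : rho (a * b) psi = rho a (rho b psi).
Proof. by rewrite frhoM comp_lfunE. Qed.
Lemma rho1 psi : rho 1 psi = psi.
Proof. by rewrite frho1 id_lfunE. Qed.
Lemma rhoA (c : R[i]) psi : rho c%:A psi = c *: psi.
Proof. by rewrite linearZ_LR scale_lfunE rho1. Qed.

Lemma iota_sqr x : fiota Y x * fiota Y x = (g x x)%:C%:A.
Proof. by case: (fCl_clifford Y) => h _ _; exact: h. Qed.

Lemma iotaC x y :
  fiota Y x * fiota Y y = - (fiota Y y * fiota Y x) + (g x y *+ 2)%:C%:A.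
Proof.
have h := iota_sqr (x + y).
move: h; rewrite linearD /= mulrDl !mulrDr !iota_sqr metricDl !metricDr (metricC y x).
rewrite !(rmorphD, scalerDl) /= ?mulr2n ?rmorphD ?scalerDl.
set a := (g x x)%:C%:A; set b := (g y y)%:C%:A; set c := (g x y)%:C%:A.
rewrite -!addrA => /addrI; rewrite !addrA => /addIr h.
by rewrite -addrA -h addrC addrK.
Qed.

Lemma vec_sqr x psi : v x (v x psi) = (g x x)%:C *: psi.
Proof. by rewrite -rhoM iota_sqr rhoA. Qed.

Lemma vec_anticomm x y psi :
  v x (v y psi) = - v y (v x psi) + (g x y *+ 2)%:C *: psi.
Proof. by rewrite -rhoM iotaC linearD linearN /= !lfun_simp rhoA rhoM. Qed.

Lemma vec_orthoC x y psi : g x y = 0 -> v x (v y psi) = - v y (v x psi).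
Proof. by move=> h; rewrite vec_anticomm h mul0rn scale0r addr0. Qed.

Lemma vec_sa x phi psi : '[v x phi, psi] = '[phi, v x psi].
Proof. exact: fform_compat. Qed.

Lemma rho_prod (s : seq X) psi :
  rho (\prod_(x <- s) fiota Y x) psi = foldr (fun x => v x) psi s.
Proof.
elim: s => [|x s IH] in psi *; first by rewrite big_nil rho1.
by rewrite big_cons rhoM IH.
Qed.

Lemma comm_rho (T : 'End(S)) : (forall x psi, v x (T psi) = T (v x psi)) ->
  forall a psi, rho a (T psi) = T (rho a psi).
Proof.
move=> h a psi; case: (fCl_clifford Y) => _ /(_ a) [s ->] _.
rewrite /word_sum; elim: s => [|w s IH].
  by rewrite !big_nil !rho0 linear0.
rewrite !big_cons !rhoD !rhoZ IH linearD linearZ; congr (_ *: _ + _).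
rewrite !rho_prod; elim: w.2 => //= x t ->; exact: h.
Qed.

Lemma schur_vec (T : 'End(S)) :
  (forall x psi, v x (T psi) = T (v x psi)) -> exists c, forall psi, T psi = c *: psi.
Proof.
move=> h; pose P f := exists a, f = rho a.
apply: (@schur _ _ P (fS_neq0 Y)).
  move=> W hW; apply: (fS_irr (s := Y)) => a psi; apply: hW; by exists a.
by move=> _ [a ->] psi; apply: comm_rho.
Qed.

(** * Averaging over a pseudo-orthonormal frame *)

(** What the averaging needs; unlike the property of being a basis, it passes
    to the tail of a list. *)
Definition frame (s : seq X) :=
  {in s, forall x, g x x * g x x = 1} /\ {in s &, forall x y, x != y -> g x y = 0}.

(** A frame vector x has inverse g(x, x) x, so this is the mean of T and of its
    conjugate by x. *)
Definition conj_avg1 (x : X) (T : 'End(S)) : 'End(S) :=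
  2^-1 *: (T + (g x x)%:C *: (v x \o T \o v x)%VF).
Definition conj_avg (s : seq X) (T : 'End(S)) := foldr conj_avg1 T s.

Lemma conj_avg1E x T psi :
  conj_avg1 x T psi = 2^-1 *: (T psi + (g x x)%:C *: v x (T (v x psi))).
Proof. by rewrite /conj_avg1 !lfun_simp. Qed.

Lemma frame_cons x s : frame (x :: s) -> frame s.
Proof.
by case=> h1 h2; split=> [y ys|y z ys zs]; [apply: h1|apply: h2];
  rewrite inE ?ys ?zs orbT.
Qed.

(** The mean over x commutes with x.  The mean over an orthogonal y preserves
    this, since x anticommutes with both outer factors of y T y. *)
Lemma conj_avg_comm s T : frame s ->
  {in s, forall x psi, v x (conj_avg s T psi) = conj_avg s T (v x psi)}.
Proof.
elim: s => // y s IH fr x xys psi; have frs := frame_cons fr.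
rewrite /= !conj_avg1E linearZ linearD linearZ /=; congr (_ *: _).
have gy : g y y * g y y = 1 by apply: fr.1; rewrite inE eqxx.
have [->|xy] := eqVneq x y.
  by rewrite !vec_sqr !linearZ /= !scalerA -rmorphM /= gy !scale1r addrC.
have xs : x \in s by move: xys; rewrite inE (negPf xy).
have gxy : g x y = 0 by apply: fr.2 => //; rewrite inE ?eqxx ?xs ?orbT.
rewrite IH //; congr (_ + _ *: _).
by rewrite (vec_orthoC _ gxy) IH // (vec_orthoC _ gxy) linearN /= linearN opprK.
Qed.

Lemma conj_avg_trace s T : frame s -> lftrace (conj_avg s T) = lftrace T.
Proof.
elim: s => // y s IH fr; rewrite /= lftraceZ lftraceD lftraceZ -comp_lfunA lftraceC.
have -> : (conj_avg s T \o v y \o v y)%VF = (g y y)%:C *: conj_avg s T.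
  by apply/lfunP => psi; rewrite !lfun_simp vec_sqr linearZ.
rewrite lftraceZ mulrA -rmorphM /= fr.1 ?inE ?eqxx // mul1r IH; last exact: frame_cons fr.
by rewrite -mulr2n -[X in _ * X]mulr_natl mulKf // pnatr_eq0.
Qed.

Definition dimS : R[i] := (\dim {:S})%:R.
Lemma dimS_gt0 : 0 < dimS.
Proof.
rewrite ltr0n lt0n dimv_eq0; case: (fS_neq0 Y) => psi; apply: contra => /eqP U0.
by rewrite -memv0 -U0 memvf.
Qed.
Lemma dimS_neq0 : dimS != 0.
Proof. by rewrite gt_eqF ?dimS_gt0. Qed.

Lemma pseudo_orthonormal_frame (b : n.-tuple X) : pseudo_orthonormal g b -> frame b.
Proof.
case=> bb h; split=> [x /tnthP[i ->]|x y /tnthP[i ->] /tnthP[j ->] ij].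
  by rewrite h eqxx /=; case: ifP => _; rewrite ?mulr1 ?mulN1r ?opprK.
by rewrite h ifT //; apply: contra ij => /eqP ->.
Qed.

Lemma basis_vecP (b : n.-tuple X) (P : X -> Prop) : basis_of fullv b ->
  P 0 -> (forall a x y, P x -> P y -> P (a *: x + y)) -> {in b, forall x, P x} ->
  forall x, P x.
Proof.
move=> bb P0 PD Pb x; rewrite (coord_basis bb (memvf x)).
elim/big_rec: _ => [//|i y _ Py]; apply: PD => //; apply: Pb.
by rewrite mem_nth ?size_tuple.
Qed.

Lemma vec0 : v 0 = 0.
Proof. by rewrite /vec_op !linear0. Qed.

Lemma comm_basis (b : n.-tuple X) (T : 'End(S)) : basis_of fullv b ->
  {in b, forall x psi, v x (T psi) = T (v x psi)} ->
  forall x psi, v x (T psi) = T (v x psi).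
Proof.
move=> bb h; apply: (basis_vecP bb) => //.
  by move=> psi; rewrite vec0 !zero_lfunE linear0.
move=> a x y hx hy psi.
by rewrite vecD vecZ !lfun_simp hx hy linearD linearZ.
Qed.

(** The average commutes with the irreducible Clifford action, so it is a scalar;
    the trace, which conjugation preserves, determines this scalar. *)
Lemma conj_avg_scalar (b : n.-tuple X) T psi : pseudo_orthonormal g b ->
  conj_avg b T psi = (lftrace T / dimS) *: psi.
Proof.
move=> pb; have fr := pseudo_orthonormal_frame pb.
have [c hc] := schur_vec (comm_basis pb.1 (conj_avg_comm T fr)).
have e : conj_avg b T = c *: \1%VF.
  by apply/lfunP => phi; rewrite hc !lfun_simp.
rewrite hc -(conj_avg_trace T fr) e lftraceZ lftrace1 mulfK //; exact: dimS_neq0.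
Qed.

(** * Definiteness of the forms of timelike vectors *)

Definition form_left (phi : S) : 'Hom(S, (R[i])^o) :=
  linfun (fun psi => '[psi, phi] : (R[i])^o).

Lemma form_leftE phi psi : form_left phi psi = '[psi, phi].
Proof.
rewrite /form_left linear_linfunE // => a x y.
by rewrite formDl formZl.
Qed.

Definition semipos (T : 'End(S)) := forall phi, 0 <= '[phi, T phi].

(** Vectors are Krein self-adjoint, so (psi, x T x psi) = (x psi, T x psi): in
    contrast to the conjugation average, this one preserves positivity. *)
Definition sandwich_avg1 (x : X) (T : 'End(S)) : 'End(S) :=
  2^-1 *: (T + (v x \o T \o v x)%VF).
Definition sandwich_avg (s : seq X) (T : 'End(S)) := foldr sandwich_avg1 T s.

Lemma sandwich_avg1E x T psi :
  sandwich_avg1 x T psi = 2^-1 *: (T psi + v x (T (v x psi))).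
Proof. by rewrite /sandwich_avg1 !lfun_simp. Qed.

Lemma conj_half : 2^-1^^* = 2^-1 :> R[i].
Proof. by rewrite conjc_inv conjc_nat. Qed.

Lemma sandwich_avg_semipos s T : semipos T -> semipos (sandwich_avg s T) /\
  forall phi, 0 < '[phi, T phi] -> 0 < '[phi, sandwich_avg s T phi].
Proof.
move=> sp; elim: s => //= x s [IH1 IH2]; split=> [phi|phi h].
  rewrite sandwich_avg1E formZr formDr [X in X * _]conj_half -vec_sa mulr_ge0 ?addr_ge0 ?invr_ge0 //.
rewrite sandwich_avg1E formZr formDr [X in X * _]conj_half -vec_sa mulr_gt0 ?invr_gt0 ?ltr0n //.
by rewrite ltr_wpDr ?IH2.
Qed.

Definition time_frame (b : n.-tuple X) (x0 : X) :=
  [/\ pseudo_orthonormal g b, x0 \in b, g x0 x0 = 1 &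
      {in b, forall x, x != x0 -> g x x = -1}].

(** The vector x0 commutes with itself and anticommutes with the other frame
    vectors, whose squares are -1; so it absorbs the sign g(x, x). *)
Lemma conj_sandwich_avg b x0 T : time_frame b x0 ->
  conj_avg b (v x0 \o T)%VF = (v x0 \o sandwich_avg b T)%VF.
Proof.
case=> pb x0b g0 gx; have fr := pseudo_orthonormal_frame pb.
suff h s : {subset s <= b} -> conj_avg s (v x0 \o T)%VF = (v x0 \o sandwich_avg s T)%VF.
  exact: h.
elim: s => //= x s IH sub.
have xb : x \in b by apply: sub; rewrite mem_head.
rewrite IH; last by move=> y ys; apply: sub; rewrite inE ys orbT.
apply/lfunP => psi; rewrite conj_avg1E !comp_lfunE sandwich_avg1E [RHS]linearZ /= [X in _ = _ *: X]linearD /=.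
congr (_ *: (_ + _)).
have [->|xx0] := eqVneq x x0; first by rewrite g0 scale1r.
by rewrite gx // rmorphN1 scaleN1r (vec_orthoC _ (fr.2 _ _ xb x0b xx0)) opprK.
Qed.

Lemma sandwich_avg_scalar b x0 T psi : time_frame b x0 ->
  sandwich_avg b T psi = (lftrace (v x0 \o T)%VF / dimS) *: v x0 psi.
Proof.
move=> tf; case: (tf) => pb _ g0 _.
have := conj_avg_scalar (v x0 \o T)%VF psi pb; rewrite (conj_sandwich_avg _ tf) comp_lfunE.
by move/(congr1 (v x0)); rewrite vec_sqr g0 scale1r linearZ.
Qed.

Lemma form_sa_real x phi : '[phi, v x phi]^^* = '[phi, v x phi].
Proof. by rewrite -formC vec_sa. Qed.

(** The form of the rank one operator (., phi) phi at psi is |(psi, phi)|^2.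
    Its sandwich average is a multiple of x0, so z(phi) (psi, x0 psi) is
    non-negative for some scalar z(phi), and positive unless (psi, phi) = 0.  As the
    Krein product is nondegenerate, (psi, x0 psi) vanishes only at 0, and one
    non-zero phi fixes its sign. *)
Lemma time_definite b x0 : time_frame b x0 ->
  krein_positive (fform Y) (v x0) \/ krein_positive (fform Y) (v (- x0)).
Proof.
move=> tf.
pose T phi := rank1 (form_left phi) phi.
have TE phi psi : '[psi, T phi psi] = '[psi, phi]^^* * '[psi, phi].
  by rewrite rank1E form_leftE formZr.
have Tsp phi : semipos (T phi) by move=> psi; rewrite TE mulrC mulcJ_ge0.
pose z phi := (lftrace (v x0 \o T phi)%VF / dimS)^^*.
have zE phi psi : '[psi, sandwich_avg b (T phi) psi] = z phi * '[psi, v x0 psi].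
  by rewrite (sandwich_avg_scalar _ _ tf) formZr.
have zge phi psi : 0 <= z phi * '[psi, v x0 psi].
  by rewrite -zE; apply: (sandwich_avg_semipos b (Tsp phi)).1.
have zgt phi psi : '[psi, phi] != 0 -> 0 < z phi * '[psi, v x0 psi].
  move=> h; rewrite -zE; apply: (sandwich_avg_semipos b (Tsp phi)).2.
  by rewrite lt_def Tsp andbT TE mulf_neq0 // conjc_eq0.
have q0 psi : psi != 0 -> '[psi, v x0 psi] != 0.
  move=> /form_nondeg[phi /zgt]; apply: contraTneq => ->.
  by rewrite mulr0 ltxx.
have [phi0 phi0N] := fS_neq0 Y.
have z0 : z phi0 != 0.
  have [psi h] := form_nondeg phi0N.
  have /zgt : '[psi, phi0] != 0 by rewrite formC conjc_eq0.
  by apply: contraTneq => ->; rewrite mul0r ltxx.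
have zpos psi : psi != 0 -> 0 < z phi0 * '[psi, v x0 psi].
  by move=> h; rewrite lt_def zge mulf_neq0 // q0.
have qr psi : '[psi, v x0 psi] \is Num.real.
  apply/complex_realP; exists (complex.Re '[psi, v x0 psi]).
  move: (form_sa_real x0 psi); case: ('[psi, v x0 psi]) => a c [] /= /eqP.
  by rewrite eq_sym -subr_eq0 opprK -mulr2n mulrn_eq0 /= => /eqP ->.
(* z phi0 is a positive number divided by a non-zero real one. *)
have zr : z phi0 \is Num.real.
  rewrite -(mulfK (q0 _ phi0N) (z phi0)) rpredM ?rpredV ?qr //.
  by rewrite gtr0_real // zpos.
have [zp|zn|ze] := real_ltgt0P zr.
- by left=> psi /zpos; rewrite pmulr_rgt0.
- right=> psi /zpos; rewrite nmulr_rgt0 // => h.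
  by rewrite -scaleN1r vecZ rmorphN1 scaleN1r opp_lfunE formNr oppr_gt0.
- by rewrite ze eqxx in z0.
Qed.

Lemma basis_flip (b : n.-tuple X) (i : 'I_n) : basis_of fullv b ->
  basis_of fullv [tuple if j == i then - tnth b j else tnth b j | j < n].
Proof.
set b' := [tuple _ | _ < _] => bb.
have dn : \dim {:X} = n by rewrite (size_basis bb).
rewrite basisEdim size_tuple dn leqnn andbT -(span_basis bb); apply/span_subvP => x.
case/tnthP => j ->.
have : tnth b' j \in <<b'>>%VS by rewrite memv_span ?mem_tnth.
by rewrite tnth_mktuple; case: ifP => // _; rewrite memvN.
Qed.

Lemma pseudo_orthonormal_flip (b : n.-tuple X) (i : 'I_n) : pseudo_orthonormal g b ->
  pseudo_orthonormal g [tuple if j == i then - tnth b j else tnth b j | j < n].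
Proof.
case=> bb h; split; first exact: basis_flip.
have gN x y : g (- x) y = - g x y by rewrite -scaleN1r metricZl mulN1r.
have gN' x y : g x (- y) = - g x y by rewrite metricC gN metricC.
move=> j k; rewrite !tnth_mktuple.
have [->|ji] := eqVneq j i; have [->|ki] := eqVneq k i; rewrite ?gN ?gN' h ?opprK //.
- by rewrite eqxx.
- by rewrite eq_sym ki oppr0.
- by rewrite ji oppr0.
Qed.

Lemma exists_time_frame : (0 < n)%N ->
  exists b x0, [/\ time_frame b x0, 0 < g x0 x0 & krein_positive (fform Y) (v x0)].
Proof.
move=> n0; have [b pb] := fg_sig Y; pose i0 := Ordinal n0.
have tf (c : n.-tuple X) : pseudo_orthonormal g c -> time_frame c (tnth c i0).
  move=> pc; split=> //; first exact: mem_tnth.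
    by rewrite pc.2 eqxx.
  move=> x /tnthP[i ->] ii; rewrite pc.2 eqxx /= ifF //.
  by apply/negbTE; apply: contra ii => /eqP e; rewrite (_ : i = i0) //; apply: val_inj.
have g1 (c : n.-tuple X) : time_frame c (tnth c i0) -> 0 < g (tnth c i0) (tnth c i0).
  by case=> _ _ ->; rewrite ltr01.
have [pos|neg] := time_definite (tf _ pb).
  by exists b, (tnth b i0); split=> //; [exact: tf|apply/g1/tf].
set b' := [tuple if j == i0 then - tnth b j else tnth b j | j < n].
have t' : time_frame b' (tnth b' i0) by apply/tf/pseudo_orthonormal_flip.
exists b', (tnth b' i0); split=> //; first exact: g1.
by rewrite tnth_mktuple eqxx.
Qed.

(** * Chirality and adjoints *)

Lemma coord_det_neq0 (o b : n.-tuple X) : basis_of fullv o -> basis_of fullv b ->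
  \det (\matrix_(i < n, j < n) coord o j (tnth b i)) != 0.
Proof.
move=> ob bb; set M := \matrix_(_, _) _.
pose N : 'M[R]_n := \matrix_(i, j) coord b j (tnth o i).
suff MN : M *m N = 1%:M.
  have : \det M * \det N = 1 by rewrite -det_mulmx MN det1.
  by move=> e; apply/eqP => M0; move/eqP: e; rewrite M0 mul0r eq_sym oner_eq0.
apply/matrixP => i k; rewrite !mxE.
have bfree := basis_free bb.
rewrite -[RHS](coord_free i k bfree) -tnth_nth.
rewrite (coord_basis ob (memvf (tnth b i))) linear_sum /=.
by apply: eq_bigr => j _; rewrite !mxE linearZ /= -tnth_nth.
Qed.

(** Flipping one vector of a frame changes the sign of its determinant. *)
Lemma oriented_flip (o b : n.-tuple X) (i : 'I_n) : basis_of fullv o ->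
  pseudo_orthonormal g b ->
  exists b' : n.-tuple X, pseudo_orthonormal g b' /\ positively_oriented o b'.
Proof.
move=> ob pb; have := coord_det_neq0 ob pb.1.
set M := \matrix_(_, _) _ => M0.
have [M_gt0|M_le0] := ltP 0 (\det M); first by exists b.
have {M_le0} M_lt0 : \det M < 0 by rewrite lt_def eq_sym M0.
exists [tuple if j == i then - tnth b j else tnth b j | j < n].
split; first exact: pseudo_orthonormal_flip.
rewrite /positively_oriented.
pose d : 'rV[R]_n := \row_j if j == i then -1 else 1.
set M' := \matrix_(_, _) _; have -> : M' = diag_mx d *m M.
  apply/matrixP => j k; rewrite mul_diag_mx !mxE tnth_mktuple.
  by case: ifP => _; rewrite ?mul1r // mulN1r linearN.
rewrite det_mulmx det_diag (bigD1 i) //= mxE eqxx big1 ?mulr1 ?mulN1r ?oppr_gt0 //.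
by move=> j ji; rewrite mxE (negPf ji).
Qed.

Lemma chi_prodE : (0 < n)%N ->
  exists2 b : n.-tuple X, pseudo_orthonormal g b &
    fchi Y = kappa *: \prod_(x <- b) fiota Y x.
Proof.
move=> n0; have [b pb] := fg_sig Y.
have [b' [pb' ob']] := oriented_flip (Ordinal n0) (forient_basis Y) pb.
by exists b' => //; apply: fchi_def.
Qed.

Local Notation chi := (rho (fchi Y)).

Lemma chi_sqr psi : chi (chi psi) = psi.
Proof. by rewrite -rhoM fchi_sqr rho1. Qed.

Lemma foldr_vec_orth (s : seq X) y psi : {in s, forall x, g y x = 0} ->
  v y (foldr (fun x => v x) psi s) = (-1) ^+ size s *: foldr (fun x => v x) (v y psi) s.
Proof.
elim: s => [|x s IH] h /=; first by rewrite expr0 scale1r.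
rewrite vec_orthoC; last by apply: h; rewrite mem_head.
rewrite IH; last by move=> z zs; apply: h; rewrite inE zs orbT.
by rewrite linearZ exprS mulN1r scaleNr.
Qed.

Lemma foldr_vecZ (s : seq X) c psi :
  foldr (fun x => v x) (c *: psi) s = c *: foldr (fun x => v x) psi s.
Proof. by elim: s => //= x s ->; rewrite linearZ. Qed.

Hypothesis n_gt0 : (0 < n)%N.
Hypothesis n_even : ~~ odd n.

Lemma pseudo_orthonormal_uniq (b : n.-tuple X) : pseudo_orthonormal g b -> uniq b.
Proof. by case=> /basis_free/free_uniq. Qed.

(** A vector of the frame passes n - 1 others in the product that defines the
    chirality, and n - 1 is odd. *)
Lemma chi_vec x psi : chi (v x psi) = - v x (chi psi).
Proof.
have [b pb chiE] := chi_prodE n_gt0; have fr := pseudo_orthonormal_frame pb.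
move: x psi; apply: (basis_vecP pb.1).
- by move=> psi; rewrite vec0 !zero_lfunE linear0 oppr0.
- move=> a x y hx hy psi.
  by rewrite vecD vecZ !lfun_simp [LHS]linearD [X in X + _]linearZ /= hx hy scalerN opprD.
move=> x xb psi; rewrite chiE !rhoZ !rho_prod linearZ /= -scalerN; congr (_ *: _).
have ub := pseudo_orthonormal_uniq pb; have sb := size_tuple b.
have /splitPr bE := xb; case: bE fr ub sb => p1 p2 fr ub sb.
have o1 : {in p1, forall y, g x y = 0}.
  move=> y yp; apply: fr.2; rewrite ?mem_cat ?mem_head ?yp ?orbT //.
  by apply: contraTneq ub => ->; rewrite cat_uniq /= yp /= andbF.
have o2 : {in p2, forall y, g x y = 0}.
  move=> y yp; apply: fr.2; rewrite ?mem_cat ?inE ?eqxx ?yp ?orbT //.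
  by apply: contraTneq ub => ->; rewrite cat_uniq /= yp !andbF.
rewrite !foldr_cat /= (foldr_vec_orth _ o1).
move: (foldr_vec_orth psi o2).
set A := foldr _ (v x psi) p2; set B := foldr _ psi p2 => e.
have -> : A = (-1) ^+ size p2 *: v x B by rewrite e scalerA -expr2 sqrr_sign scale1r.
rewrite linearZ /= foldr_vecZ -scaleN1r scalerA -exprS; congr (_ *: _).
have : ~~ odd (size (p1 ++ x :: p2)) by rewrite sb.
rewrite size_cat /= addnS /= oddD negbK -signr_odd -[RHS]signr_odd /=.
by case: (odd (size p1)); case: (odd (size p2)).
Qed.

Lemma rho_prod_adjoint (s : seq X) phi psi :
  '[rho (\prod_(x <- s) fiota Y x) phi, psi] =
  '[phi, rho (\prod_(x <- rev s) fiota Y x) psi].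
Proof.
rewrite !rho_prod; elim: s phi psi => //= x s IH phi psi.
by rewrite vec_sa IH rev_cons foldr_rcons.
Qed.

(** The adjoint reverses words and conjugates their coefficients. *)
Lemma rho_adjoint a : exists a', adjoint_of (fform Y) (rho a) (rho a') /\
  (clifford_even (fiota Y) a -> clifford_even (fiota Y) a').
Proof.
pose adj := map (fun w : R[i] * seq X => (w.1^^*, rev w.2)).
have adjP s : adjoint_of (fform Y) (rho (word_sum (fiota Y) s))
    (rho (word_sum (fiota Y) (adj s))).
  rewrite /word_sum; elim: s => [|w s IH] phi psi.
    by rewrite !big_nil !rho0 form0l form0r.
  rewrite /= !big_cons !rhoD !rhoZ formDl formDr formZl formZr /= IH.
  by rewrite rho_prod_adjoint revK.
have [ae|ane] := EM (clifford_even (fiota Y) a).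
  case: (ae) => s sE aE; exists (word_sum (fiota Y) (adj s)); split.
    by rewrite aE; apply: adjP.
  move=> _; exists (adj s) => //; rewrite all_map; apply: sub_all sE => w /=.
  by rewrite size_rev.
case: (fCl_clifford Y) => _ /(_ a) [s aE] _.
by exists (word_sum (fiota Y) (adj s)); split=> //; rewrite aE; apply: adjP.
Qed.

Lemma adjoint_sym (A B : S -> S) : adjoint_of (fform Y) A B -> adjoint_of (fform Y) B A.
Proof. by move=> h phi psi; rewrite formC -h -formC. Qed.

(** The adjoint of chi anticommutes with the vectors, as chi does, so by Schur's
    lemma it is c chi, and c is 1 or -1.  If c = 1 then
    (chi th, x0 chi th) = - (th, x0 th), against definiteness. *)
Lemma chi_anti_sa phi psi : '[chi phi, psi] = - '[phi, chi psi].
Proof.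
have [a [adj _]] := rho_adjoint (fchi Y); pose A := rho a.
have adj' := adjoint_sym adj.
have Av x th : A (v x th) = - v x (A th).
  by apply: form_eqP => th'; rewrite formNl adj !vec_sa adj chi_vec formNr opprK.
have [c hc] : exists c, forall th, A th = c *: chi th.
  have [|c hc] := @schur_vec (chi \o A)%VF.
    by move=> x th; rewrite !comp_lfunE Av linearN /= chi_vec opprK.
  by exists c => th; rewrite -[A th]chi_sqr; move: (hc th); rewrite comp_lfunE => ->; rewrite linearZ.
have c2 : c * c = 1.
  have [th th0] := fS_neq0 Y; have [th' h] := form_nondeg th0.
  have : '[A (A th), th'] = '[th, th'] by rewrite !adj chi_sqr.
  rewrite !hc linearZ /= chi_sqr scalerA formZl => e.
  by apply: (mulIf h); rewrite mul1r.
(* c = 1 contradicts the positivity of the form of x0 at th and at chi th. *)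
have cN1 : c = -1.
  have /eqP : c ^+ 2 = 1 by rewrite expr2.
  rewrite sqrf_eq1 => /orP[] /eqP // c1.
  have [b [x0 [_ _ pos]]] := exists_time_frame n_gt0.
  have [th th0] := fS_neq0 Y.
  have chi0 : chi th != 0 by apply: contra th0 => /eqP e; rewrite -(chi_sqr th) e linear0.
  have := pos _ chi0; rewrite -{1}[chi th]scale1r -c1 -hc adj chi_vec chi_sqr formNr.
  by rewrite oppr_gt0 => /lt_gtF; rewrite pos.
have -> : chi phi = - A phi by rewrite hc cN1 scaleN1r opprK.
by rewrite formNl adj.
Qed.

(** * Burnside's theorem and the even algebra *)

(** As a function of psi, the average of the rank one operator with image psi,
    evaluated at alpha, is a combination of Clifford words applied to psi.  By
    conj_avg_scalar it equals f(psi) alpha / dim S. *)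
Lemma rank1_in_rho (f : 'Hom(S, (R[i])^o)) alpha : exists a, rank1 f alpha = rho a.
Proof.
have key s : exists a, forall psi, conj_avg s (rank1 f psi) alpha = rho a psi.
  elim: s alpha => [|x s IH] alpha.
    by exists (f alpha : R[i])%:A => psi; rewrite rank1E rhoA.
  have [a ha] := IH alpha; have [a' ha'] := IH (v x alpha).
  exists (2^-1 *: (a + (g x x)%:C *: (fiota Y x * a'))) => psi.
  by rewrite conj_avg1E ha ha' !(rhoZ, rhoD) rhoM.
have [b pb] := fg_sig Y; have [a ha] := key b.
exists (dimS *: a); apply/lfunP => psi.
rewrite rhoZ -ha (conj_avg_scalar _ _ pb) lftrace_rank1 rank1E scalerA mulrC.
by rewrite mulfVK ?dimS_neq0.
Qed.

Lemma burnside (T : 'End(S)) : exists a, rho a = T.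
Proof.
pose e := vbasis {:S}.
have -> : T = \sum_j rank1 (linfun (coord e j : S -> (R[i])^o)) (T e`_j).
  apply/lfunP => psi; rewrite sum_lfunE {1}(coord_vbasis (memvf psi)) linear_sum.
  by apply: eq_bigr => j _; rewrite rank1E lfunE linearZ.
elim/big_ind: _ => [|f1 f2 [a1 <-] [a2 <-]|j _].
- by exists 0; rewrite linear0.
- by exists (a1 + a2); rewrite linearD.
have [a ->] := rank1_in_rho (linfun (coord e j : S -> (R[i])^o)) (T e`_j).
by exists a.
Qed.

Lemma half_double (x : S) : 2^-1 *: (x + x) = x.
Proof.
by rewrite -mulr2n -[X in _ *: X]scaler_nat scalerA mulVf ?pnatr_eq0 ?scale1r.
Qed.

Lemma chi_word (w : seq X) psi :
  chi (foldr (fun x => v x) psi w) = (-1) ^+ size w *: foldr (fun x => v x) (chi psi) w.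
Proof.
elim: w => [|x w IH] /=; first by rewrite expr0 scale1r.
by rewrite chi_vec IH linearZ exprS mulN1r scaleNr.
Qed.

Lemma even_chiC a psi : clifford_even (fiota Y) a -> chi (rho a psi) = rho a (chi psi).
Proof.
case=> s sE ->; rewrite /word_sum; elim: s sE => [|w s IH] /=.
  by rewrite !big_nil !rho0 linear0.
case/andP => we /IH e; rewrite !big_cons !rhoD !rhoZ linearD linearZ /= e; congr (_ *: _ + _).
by rewrite !rho_prod chi_word -signr_odd (negPf we) expr0 scale1r.
Qed.

(** The mean of a word and of its conjugate by chi is the word itself or 0,
    according to the parity of its length. *)
Lemma chiC_even (T : 'End(S)) : (forall psi, chi (T psi) = T (chi psi)) ->
  exists2 a, clifford_even (fiota Y) a & rho a = T.
Proof.
move=> Tchi; have [a aT] := burnside T.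
case: (fCl_clifford Y) => _ /(_ a) [s sE] _.
pose s0 := [seq w <- s | ~~ odd (size w.2)].
exists (word_sum (fiota Y) s0); first by exists s0 => //; exact: filter_all.
suff h psi : rho (word_sum (fiota Y) s0) psi =
    2^-1 *: (rho (word_sum (fiota Y) s) psi + chi (rho (word_sum (fiota Y) s) (chi psi))).
  by apply/lfunP => psi; rewrite h -sE aT Tchi chi_sqr half_double.
rewrite /s0 /word_sum big_filter; elim: s {sE s0} => [|w s IH].
  by rewrite !big_nil !rho0 linear0 addr0 scaler0.
have -> : chi (rho (\sum_(v0 <- w :: s) v0.1 *: \prod_(x <- v0.2) fiota Y x) (chi psi)) =
    (-1) ^+ odd (size w.2) *: (w.1 *: rho (\prod_(x <- w.2) fiota Y x) psi) +
    chi (rho (\sum_(v0 <- s) v0.1 *: \prod_(x <- v0.2) fiota Y x) (chi psi)).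
  rewrite big_cons rhoD rhoZ [LHS]linearD [X in X + _]linearZ /= !rho_prod chi_word chi_sqr.
  by rewrite signr_odd !scalerA mulrC.
rewrite !big_cons rhoD rhoZ [in RHS]addrACA scalerDr -IH.
case: (odd (size w.2)) => /=.
  by rewrite expr1 scaleN1r subrr scaler0 add0r.
by rewrite expr0 scale1r half_double rhoD rhoZ.
Qed.

(** * Faithfulness of the Clifford representation *)

(** A combination of the ordered monomials in the vectors of s, written
    recursively. *)
Fixpoint normal_form (s : seq X) (a : fCl Y) : Prop :=
  if s is x :: s' then
    exists a0 a1, [/\ normal_form s' a0, normal_form s' a1 & a = a0 + fiota Y x * a1]
  else exists c, a = c%:A.

Lemma normal_form_lin s c a a' : normal_form s a -> normal_form s a' ->
  normal_form s (c *: a + a').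
Proof.
elim: s a a' => [|x s IH] a a' /=.
  by move=> [k ->] [k' ->]; exists (c * k + k'); rewrite scalerDl scalerA.
move=> [a0 [a1 [h0 h1 ->]]] [b0 [b1 [k0 k1 ->]]].
exists (c *: a0 + b0), (c *: a1 + b1); split; [exact: IH|exact: IH|].
by rewrite scalerDr mulrDr -scalerAr addrACA.
Qed.

Lemma normal_form0 s : normal_form s 0.
Proof.
elim: s => [|x s IH] /=; first by exists 0; rewrite scale0r.
by exists 0, 0; split=> //; rewrite mulr0 addr0.
Qed.

Lemma normal_form1 s : normal_form s 1.
Proof.
elim: s => [|x s IH] /=; first by exists 1; rewrite scale1r.
by exists 1, 0; split=> //; [exact: normal_form0|rewrite mulr0 addr0].
Qed.

Lemma normal_form_scale s c a : normal_form s a -> normal_form s (c *: a).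
Proof. by move=> h; rewrite -[_ *: _]addr0; apply: normal_form_lin => //; apply: normal_form0. Qed.

Lemma normal_form_mul s x a : frame s -> x \in s ->
  normal_form s a -> normal_form s (fiota Y x * a).
Proof.
elim: s x a => // y s IH x a fr xs /= [a0 [a1 [h0 h1 ->]]].
have frs := frame_cons fr.
have [->|xy] := eqVneq x y.
  exists ((g y y)%:C *: a1), a0; split=> //; first exact: normal_form_scale.
  by rewrite mulrDr mulrA iota_sqr -scalerAl mul1r addrC.
have xs' : x \in s by move: xs; rewrite inE (negPf xy).
exists (fiota Y x * a0), (- 1 *: (fiota Y x * a1)); split.
- exact: IH.
- by apply: normal_form_scale; apply: IH.
rewrite mulrDr mulrA iotaC fr.2 ?mem_head // mul0rn scale0r addr0.
by rewrite scaleN1r mulrN mulrA mulNr.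
Qed.

Lemma all_normal_form (b : n.-tuple X) a : pseudo_orthonormal g b -> normal_form b a.
Proof.
move=> pb; have fr := pseudo_orthonormal_frame pb.
have hv : forall x a, normal_form b a -> normal_form b (fiota Y x * a).
  apply: (basis_vecP pb.1) => [a' _|c x y hx hy a' h|x xb a' h].
  - by rewrite linear0 mul0r; apply: normal_form0.
  - rewrite linearD linearZ_LR /= mulrDl -scalerAl.
    by apply: normal_form_lin; [apply: hx|apply: hy].
  - exact: normal_form_mul.
case: (fCl_clifford Y) => _ /(_ a) [s ->] _; rewrite /word_sum.
elim: s => [|w s IH]; first by rewrite big_nil; apply: normal_form0.
rewrite big_cons; apply: normal_form_lin => //.
elim: w.2 => [|x t IHt]; first by rewrite big_nil; apply: normal_form1.
by rewrite big_cons; apply: hv.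
Qed.

Lemma rho_vecM x a psi : rho (fiota Y x * a) psi = v x (rho a psi).
Proof. exact: rhoM. Qed.

Lemma normal_form_comm s a (T : 'End(S)) : normal_form s a ->
  {in s, forall x psi, T (v x psi) = v x (T psi)} ->
  forall psi, T (rho a psi) = rho a (T psi).
Proof.
elim: s a => [|x s IH] a /= => [[c ->] _ psi|[a0 [a1 [h0 h1 ->]]] h psi].
  by rewrite !rhoA linearZ.
have hs : {in s, forall x psi, T (v x psi) = v x (T psi)}.
  by move=> y ys; apply: h; rewrite inE ys orbT.
by rewrite !rhoD !rho_vecM linearD /= h ?mem_head // !IH.
Qed.

(** The operator chi x commutes with the other frame vectors and anticommutes
    with x.  Commuting it past a0 + x a1 changes the sign of the second term, so both
    terms act by zero. *)
Lemma normal_form_inj s a : frame s -> uniq s -> normal_form s a ->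
  (forall psi, rho a psi = 0) -> a = 0.
Proof.
elim: s a => [|x s IH] a /= fr.
  move=> _ [c ->] h; have [psi p0] := fS_neq0 Y.
  by move: (h psi) => /eqP; rewrite rhoA scaler_eq0 (negPf p0) orbF => /eqP ->; rewrite scale0r.
case/andP => xs us [a0 [a1 [h0 h1 ->]]] h; have frs := frame_cons fr.
have gx : (g x x)%:C != 0.
  apply/eqP => /complexI gx; have := fr.1 x (mem_head _ _).
  by rewrite gx mul0r => /eqP; rewrite eq_sym oner_eq0.
pose E := (chi \o v x)%VF.
have EE psi : E (E psi) = - (g x x)%:C *: psi.
  by rewrite !comp_lfunE chi_vec chi_sqr vec_sqr scaleNr.
have Ecomm : {in s, forall y psi, E (v y psi) = v y (E psi)}.
  move=> y ys psi; have yx : x != y by apply: contra xs => /eqP ->.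
  have gxy : g x y = 0 by apply: fr.2; rewrite ?mem_head ?inE ?ys ?orbT.
  by rewrite !comp_lfunE (vec_orthoC _ gxy) linearN /= [in LHS]chi_vec opprK.
have Ex psi : E (v x psi) = - v x (E psi).
  by rewrite !comp_lfunE chi_vec.
have z psi : rho a0 psi = 0 /\ v x (rho a1 psi) = 0.
  (* E th = psi, because E E = - g(x, x) *)
  pose th := - (g x x)%:C^-1 *: E psi.
  have Eth : E th = psi by rewrite linearZ /= EE scalerA mulrNN mulVf ?scale1r.
  have e1 : rho a0 psi + v x (rho a1 psi) = 0 by rewrite -[RHS](h psi) rhoD rho_vecM.
  have e2 : rho a0 psi - v x (rho a1 psi) = 0.
    have := congr1 E (h th).
    rewrite linear0 rhoD rho_vecM linearD /= Ex.
    by rewrite (normal_form_comm h0 Ecomm) (normal_form_comm h1 Ecomm) Eth.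
  have e : rho a0 psi = 0.
    by rewrite -[rho a0 psi]half_double -[X in X + _](addrK (v x (rho a1 psi))) e1 -addrA
       [- _ + _]addrC e2 addr0 scaler0.
  by split=> //; move: e1; rewrite e add0r.
have a00 : a0 = 0 by apply: IH => // psi; case: (z psi).
have a10 : a1 = 0.
  apply: IH => // psi; case: (z psi) => _ /(congr1 (v x)).
  rewrite vec_sqr linear0 => /eqP.
  by rewrite scaler_eq0 (negPf gx) => /eqP.
by rewrite a00 a10 mulr0 addr0.
Qed.

Lemma rho_inj a a' : (forall psi, rho a psi = rho a' psi) -> a = a'.
Proof.
move=> h; apply/eqP; rewrite -subr_eq0; apply/eqP.
have [b pb] := fg_sig Y.
apply: (normal_form_inj (pseudo_orthonormal_frame pb) (pseudo_orthonormal_uniq pb) (all_normal_form _ pb)) => psi.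
by rewrite -scaleN1r rhoD rhoZ h scaleN1r subrr.
Qed.

(** * Chiral projections and the odd bimodule *)

Definition chiral_proj (s : bool) : 'End(S) := 2^-1 *: (\1 + (-1) ^+ s *: chi)%VF.
Local Notation P := chiral_proj.

Lemma chiral_projE s psi : P s psi = 2^-1 *: (psi + (-1) ^+ s *: chi psi).
Proof. by rewrite /P !lfun_simp. Qed.

Lemma chiral_proj_sum psi : P false psi + P true psi = psi.
Proof.
rewrite !chiral_projE -scalerDr expr0 expr1 scale1r scaleN1r addrACA subrr addr0.
exact: half_double.
Qed.

Lemma chi_proj (s : bool) psi : chi (P s psi) = (-1) ^+ s *: P s psi.
Proof.
rewrite chiral_projE linearZ linearD linearZ /= chi_sqr [RHS]scalerA mulrC -[RHS]scalerA.
by rewrite [X in _ = _ *: X]scalerDr scalerA -expr2 sqrr_sign scale1r addrC.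
Qed.

Lemma proj_chi (s : bool) psi : P s (chi psi) = (-1) ^+ s *: P s psi.
Proof. by rewrite -chi_proj !chiral_projE [RHS]linearZ [X in _ = _ *: X]linearD [X in _ = _ *: (_ + X)]linearZ. Qed.

Lemma proj_id (s : bool) psi : chi psi = (-1) ^+ s *: psi -> P s psi = psi.
Proof.
by move=> h; rewrite chiral_projE h scalerA -expr2 sqrr_sign scale1r half_double.
Qed.

Lemma odd_proj (A : 'End(S)) s psi : odd_operator A -> A (P s psi) = P (~~ s) (A psi).
Proof.
move=> oA; rewrite !chiral_projE linearZ linearD linearZ /= oA scalerN -scaleNr.
by case: s; rewrite ?expr0 ?expr1 ?opprK.
Qed.

Lemma vec_odd x : odd_operator (v x).
Proof. by move=> psi; rewrite chi_vec opprK. Qed.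

Lemma form_proj s phi psi : '[P s phi, psi] = '[phi, P (~~ s) psi].
Proof.
rewrite !chiral_projE formZl formZr [X in _ = X * _]conj_half; congr (_ * _).
rewrite formDl formDr formZl formZr chi_anti_sa rmorph_sign mulrN -mulNr.
by case: s; rewrite /= ?expr0 ?expr1 ?opprK.
Qed.

Definition chi_commuting (A : 'End(S)) := forall psi, chi (A psi) = A (chi psi).

(** Sum over a basis e_j: the operator C_j picks the coordinate of index j of the
    projection to chirality s and places it on psi, and A_j sends gamma psi to
    T (P_s e_j). *)
Lemma odd_bimodule_half (gamma T : 'End(S)) (s : bool) psi :
    odd_operator gamma -> odd_operator T ->
    chi psi = (-1) ^+ s *: psi -> gamma psi != 0 ->
  exists r : seq ('End(S) * 'End(S)),
    (forall w, w \in r -> chi_commuting w.1 /\ chi_commuting w.2) /\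
    forall th, T (P s th) = \sum_(w <- r) w.1 (gamma (w.2 th)).
Proof.
move=> og oT hpsi /[dup] gpsi /form_nondeg[th' nz].
pose f := (('[gamma psi, th'])^-1 *: form_left th' \o P (~~ s))%VF.
pose e := vbasis {:S}.
pose C j := (rank1 (linfun (coord e j : S -> (R[i])^o)) psi \o P s)%VF.
pose A (j : 'I_(\dim {:S})) := rank1 f (T (P s e`_j)).
have fg : f (gamma psi) = 1.
  rewrite comp_lfunE -odd_proj // proj_id // scale_lfunE form_leftE.
  exact: mulVf.
exists [seq (A j, C j) | j <- enum 'I_(\dim {:S})]; split.
  move=> _ /mapP[j _ ->]; split=> th /=.
    have cT : chi (T (P s e`_j)) = (-1) ^+ (~~ s) *: T (P s e`_j).
      apply: oppr_inj; rewrite -oT chi_proj linearZ /= -scaleNr; congr (_ *: _).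
      by case: (s); rewrite ?expr0 ?expr1 ?opprK.
    rewrite /A !rank1E linearZ /= cT scalerA; congr (_ *: _).
    by rewrite [RHS]comp_lfunE proj_chi linearZ [in LHS]comp_lfunE mulrC.
  rewrite /C !rank1_compE linearZ /= hpsi proj_chi [in RHS]linearZ /= scalerA; congr (_ *: _).
  by rewrite mulrC.
move=> th; rewrite big_map big_enum /=; set p := P s th.
have Cp j : C j th = (coord e j p : R[i]) *: psi by rewrite /C rank1_compE lfunE.
have Ap j k : A j (gamma (k *: psi)) = k *: T (P s e`_j).
  rewrite /A rank1E; congr (_ *: _).
  by rewrite [X in f X]linearZ [LHS]linearZ /= fg [LHS]mulr1.
transitivity (T (P s p)); first by rewrite (proj_id (chi_proj s th)).
rewrite (coord_vbasis (memvf p)) !linear_sum; apply: eq_bigr => j _.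
by rewrite Cp Ap !linearZ.
Qed.

Lemma odd_bimodule (gamma T : 'End(S)) :
    odd_operator gamma -> odd_operator T ->
    (exists2 psi, left_spinor psi & gamma psi != 0) ->
    (exists2 psi, right_spinor psi & gamma psi != 0) ->
  exists r : seq ('End(S) * 'End(S)),
    (forall w, w \in r -> chi_commuting w.1 /\ chi_commuting w.2) /\
    forall th, T th = \sum_(w <- r) w.1 (gamma (w.2 th)).
Proof.
move=> og oT [p1 l1 g1] [p2 l2 g2].
have [|r1 [c1 e1]] := @odd_bimodule_half _ _ true _ og oT _ g1.
  by rewrite expr1 scaleN1r.
have [|r2 [c2 e2]] := @odd_bimodule_half _ _ false _ og oT _ g2.
  by rewrite expr0 scale1r.
exists (r2 ++ r1); split=> [w|th].
  by rewrite mem_cat => /orP[/c2|/c1].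
by rewrite -{1}(chiral_proj_sum th) linearD /= e1 e2 big_cat.
Qed.

(** * The commutant of the even algebra *)

(** For a unit timelike x0 the operator T + x0 T x0 commutes with all vectors,
    and T - x0 T x0 anticommutes with them.  The first one, and chi times the second
    one, are scalars by Schur's lemma. *)
Lemma even_commutant (T : 'End(S)) :
    (forall x y psi, T (v x (v y psi)) = v x (v y (T psi))) ->
  exists l m, forall psi, T psi = l *: psi + m *: chi psi.
Proof.
move=> hT; have [b [x0 [[pb x0b g0 _] _ _]]] := exists_time_frame n_gt0.
have x0K psi : v x0 (v x0 psi) = psi by rewrite vec_sqr g0 scale1r.
have hT0 y psi : v x0 (T (v x0 (v y psi))) = v y (T psi).
  by rewrite hT x0K.
have [|l hl] := @schur_vec (T + (v x0 \o T \o v x0))%VF.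
  move=> y psi; rewrite !lfun_simp /= hT0 linearD /= addrC; congr (_ + _).
  by rewrite -hT x0K.
have [|m hm] := @schur_vec (chi \o (T - (v x0 \o T \o v x0)))%VF.
  move=> y psi; rewrite !lfun_simp /= hT0 -[LHS]opprK -chi_vec -linearN /= linearB /=.
  by rewrite -[v y (v x0 _)]hT x0K opprB.
exists (2^-1 * l), (2^-1 * m) => psi.
have e : m *: chi psi = (T - (v x0 \o T \o v x0))%VF psi.
  by rewrite -[RHS]chi_sqr -[X in _ = chi X]comp_lfunE hm linearZ.
rewrite -!scalerA -hl e -scalerDr !lfun_simp.
by rewrite addrACA subrr addr0 half_double.
Qed.

(** * Traces and the antilinear structure *)

Local Notation J := (fJ Y).

Lemma conjR (r : R) : (r%:C)^^* = r%:C.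
Proof. exact: conjc_real. Qed.
Lemma JZ (c : R[i]) psi : J (c *: psi) = c^^* *: J psi.
Proof. by rewrite linearZ_LR. Qed.
Lemma JD phi psi : J (phi + psi) = J phi + J psi.
Proof. exact: linearD. Qed.
Lemma J_inj : injective J.
Proof.
move=> p q /(congr1 J); rewrite !fJ_sqr => /scalerI; apply.
by rewrite /sgn_eps; case: ifP; rewrite ?oner_neq0 // oppr_eq0 oner_neq0.
Qed.

Lemma J_conj_avg s (T T' : 'End(S)) : (forall psi, J (T psi) = T' (J psi)) ->
  forall psi, J (conj_avg s T psi) = conj_avg s T' (J psi).
Proof.
move=> h; elim: s => //= x s IH psi.
rewrite !conj_avg1E JZ [X in X *: _]conj_half JD JZ conjR IH; congr (_ *: (_ + _ *: _)).
by rewrite fJ_vec IH fJ_vec linearN /= linearN opprK.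
Qed.

(** J carries the average of T to the average of T', and both are scalars. *)
Lemma J_trace (T T' : 'End(S)) : (forall psi, J (T psi) = T' (J psi)) ->
  lftrace T' = (lftrace T)^^*.
Proof.
move=> h; have [b pb] := fg_sig Y; have [psi p0] := fS_neq0 Y.
have Jp0 : J psi != 0 by apply: contra p0 => /eqP e; apply/eqP/J_inj; rewrite e linear0.
have := J_conj_avg b h psi; rewrite !(conj_avg_scalar _ _ pb) JZ.
move/eqP; rewrite -subr_eq0 -scalerBl scaler_eq0 (negPf Jp0) orbF subr_eq0 => /eqP.
rewrite rmorphM /= conjc_inv /dimS conjc_nat => /mulIf e; apply/esym/e.
by rewrite invr_eq0 dimS_neq0.
Qed.

(** * Future-directed vectors *)

(** This follows from (z phi, z (z phi)) = g(z, z) (phi, z phi). *)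
Lemma krein_positive_timelike (z : X) : krein_positive (fform Y) (v z) -> timelike z.
Proof.
move=> pos; have [phi phi0] := fS_neq0 Y; have p1 := pos _ phi0.
have z0 : v z phi != 0 by apply: contraTneq p1 => ->; rewrite form0r ltxx.
have := pos _ z0; rewrite vec_sqr formZr conjR vec_sa pmulr_lgt0 //.
by rewrite -[0]/(0%:C) ltcR.
Qed.

Lemma krein_positive_future (z : X) : krein_positive (fform Y) (v z) -> future_directed z.
Proof. by move=> pos; split=> //; apply: krein_positive_timelike. Qed.

Lemma future_add (x y : X) : future_directed x -> future_directed y -> future_directed (x + y).
Proof.
move=> [_ px] [_ py]; apply: krein_positive_future => phi p0.
by rewrite vecD add_lfunE formDr addr_gt0 ?px ?py.
Qed.

Lemma future_scale (a : R) (x : X) : 0 < a -> future_directed x -> future_directed (a *: x).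
Proof.
move=> a0 [_ px]; apply: krein_positive_future => phi p0.
by rewrite vecZ scale_lfunE formZr conjR mulr_gt0 ?px // -[0]/(0%:C) ltcR.
Qed.

Lemma vecN x : v (- x) = - v x.
Proof. by rewrite -scaleN1r vecZ rmorphN1 scaleN1r. Qed.

Lemma vec_sandwich u x psi :
  v u (v x (v u psi)) = v ((g u x *+ 2) *: u - g u u *: x) psi.
Proof.
rewrite vec_anticomm vec_sqr linearZ /= addrC.
by rewrite vecD vecN !vecZ !lfun_simp.
Qed.

(** The sandwich u x u is 2 g(u, x) u - g(u, u) x, and its form at phi is the
    form of x at u phi. *)
Lemma krein_positive_from u x : krein_positive (fform Y) (v x) ->
  0 < g u u -> 0 < g u x -> krein_positive (fform Y) (v u).
Proof.
move=> px uu ux phi p0.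
have uphi : v u phi != 0.
  apply: contra p0 => /eqP e; have := vec_sqr u phi; rewrite e linear0 => /esym/eqP.
  by rewrite scaler_eq0 => /orP[/eqP/complexI e'|//]; rewrite e' ltxx in uu.
have h := px _ uphi; have h' := px _ p0.
have : 0 < '[phi, v ((g u x *+ 2) *: u) phi].
  rewrite -[(g u x *+ 2) *: u](subrK (g u u *: x)) vecD add_lfunE formDr.
  rewrite addr_gt0 //; first by rewrite -vec_sandwich -vec_sa.
  by rewrite vecZ scale_lfunE formZr conjR mulr_gt0 // -[0]/(0%:C) ltcR.
rewrite vecZ scale_lfunE formZr conjR pmulr_rgt0 //.
by rewrite -[0]/(0%:C) ltcR pmulrn_lgt0.
Qed.

Lemma conj_gt0 (z : R[i]) : 0 < z^^* -> 0 < z.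
Proof. by case: z => a c; rewrite !ltcE /= oppr_eq0. Qed.

(** The sandwich average of T is tr(x0 T) / dim S times x0. *)
Lemma trace_semipos b x0 T phi : time_frame b x0 -> krein_positive (fform Y) (v x0) ->
  semipos T -> 0 < '[phi, T phi] -> 0 < lftrace (v x0 \o T)%VF.
Proof.
move=> tf px sT h; have := (sandwich_avg_semipos b sT).2 _ h.
have p0 : phi != 0 by apply: contraTneq h => ->; rewrite form0l ltxx.
rewrite (sandwich_avg_scalar _ _ tf) formZr pmulr_lgt0 ?px // => c0.
by move: (conj_gt0 c0); rewrite pmulr_lgt0 // invr_gt0; exact: dimS_gt0.
Qed.

(** * The vector part of an operator *)

Definition trace_pairing (T : 'End(S)) (x : X) : R := complex.Re (lftrace (T \o v x)%VF).

Lemma ReD (z w : R[i]) : complex.Re (z + w) = complex.Re z + complex.Re w.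
Proof. by case: z => ? ?; case: w. Qed.
Lemma ReZ (a : R) (z : R[i]) : complex.Re (a%:C * z) = a * complex.Re z.
Proof. by case: z => ? ? /=; rewrite mul0r subr0. Qed.

Lemma trace_pairing_lin T (a : R) x y : trace_pairing T (a *: x + y) = a * trace_pairing T x + trace_pairing T y.
Proof.
rewrite /trace_pairing -ReZ -ReD -lftraceZD; congr (complex.Re (lftrace _)).
by apply/lfunP => psi; rewrite vecD vecZ !lfun_simp linearD linearZ.
Qed.

Lemma metric_inj u w : (forall x, g u x = g w x) -> u = w.
Proof.
move=> h; have [b pb] := fg_sig Y; have fr := pseudo_orthonormal_frame pb.
have coordE z i : g z (tnth b i) = coord b i z * g (tnth b i) (tnth b i).
  rewrite {1}(coord_basis pb.1 (memvf z)) linear_sumlz (bigD1 i) //= big1 ?addr0.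
    by rewrite linearZl_LR /= -tnth_nth.
  by move=> j ji; rewrite linearZl_LR /= -tnth_nth pb.2 ji mulr0.
rewrite (coord_basis pb.1 (memvf u)) (coord_basis pb.1 (memvf w)).
apply: eq_bigr => i _; congr (_ *: _); have := h (tnth b i); rewrite (coordE u) (coordE w) => /mulIf; apply.
by rewrite pb.2 eqxx /=; case: ifP; rewrite ?oner_neq0 // oppr_eq0 oner_neq0.
Qed.

Lemma exists_vector_part T : exists u, forall x, g u x = trace_pairing T x.
Proof.
have [b pb] := fg_sig Y.
exists (\sum_i (trace_pairing T (tnth b i) * g (tnth b i) (tnth b i)) *: tnth b i).
apply: (basis_vecP pb.1).
- have -> : trace_pairing T 0 = 0.
    by have := trace_pairing_lin T (-1) 0 0; rewrite scaler0 addr0 mulN1r addNr.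
  by rewrite -[0](scale0r 0) metricZr mul0r.
- by move=> a x y hx hy; rewrite metricDr metricZr hx hy trace_pairing_lin.
move=> _ /tnthP[i ->]; rewrite linear_sumlz (bigD1 i) //= big1 ?addr0.
  by rewrite linearZl_LR /= -mulrA (pseudo_orthonormal_frame pb).1 ?mulr1 ?mem_tnth.
by move=> j ji; rewrite linearZl_LR /= [X in _ * X]pb.2 ji mulr0.
Qed.

(** The vector that represents the linear form x -> Re tr(T x). *)
Definition vector_part T := projT1 (cid (exists_vector_part T)).
Lemma vector_partE T x : g (vector_part T) x = trace_pairing T x.
Proof. exact: (projT2 (cid (exists_vector_part T))). Qed.

Definition axis T := (Num.sqrt (g (vector_part T) (vector_part T)))^-1 *: vector_part T.

Lemma axisZ T (c : R[i]) : 0 < c -> axis (c *: T) = axis T.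
Proof.
move=> c0.
have [r [r0 ->]] : exists r, 0 < r /\ c = r%:C.
  case: c c0 => r i; rewrite ltcE /= => /andP[/eqP -> r0]; by exists r.
have e : vector_part (r%:C *: T) = r *: vector_part T.
  apply: metric_inj => x; rewrite metricZl !vector_partE /trace_pairing -ReZ -lftraceZ.
  by rewrite comp_lfunZl.
rewrite /axis e metricZl metricZr mulrA -expr2 sqrtrM ?sqr_ge0 // sqrtr_sqr gtr0_norm //.
by rewrite scalerA invfM mulrAC mulVf ?mul1r // gt_eqF.
Qed.

Lemma timelike_axis T : 0 < g (vector_part T) (vector_part T) ->
  krein_positive (fform Y) (v (vector_part T)) -> future_directed (axis T).
Proof.
move=> tl pos; apply: future_scale; first by rewrite invr_gt0 sqrtr_gt0.
exact: krein_positive_future.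
Qed.

(** Two spacelike frame vectors span a plane, which contains a vector orthogonal
    to u. *)
Lemma exists_ortho u : (2 < n)%N -> exists z, g u z = 0 /\ g z z != 0.
Proof.
move=> n2; have [b pb] := fg_sig Y.
have n1 : (1 < n)%N by apply: ltn_trans n2.
pose i1 := Ordinal n1; pose i2 := Ordinal n2.
pose p := tnth b i1; pose q := tnth b i2.
have pp : g p p = -1 by rewrite pb.2 eqxx.
have qq : g q q = -1 by rewrite pb.2 eqxx.
have pq : g p q = 0 by rewrite pb.2.
have [u1|u1] := eqVneq (g u p) 0.
  by exists p; rewrite u1 pp oppr_eq0 oner_neq0.
(* The combination of p and q orthogonal to u; its square is -(k^2 + m^2). *)
pose k : R := g u q; have [m mE] : exists m : R, m = - g u p by exists (- g u p).
pose z : X := k *: p + m *: q.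
have gz x : g x z = k * g x p + m * g x q by rewrite -!metricZr -metricDr.
exists z; split; first by rewrite gz /k mE mulrC mulNr subrr.
rewrite gz (metricC z p) (metricC z q) !gz pp qq (metricC q p) pq.
rewrite !(mulr0, addr0, add0r, mulrN1, mulrN).
have km : 0 < k * k + m * m.
  by rewrite -!expr2 ltr_wpDl ?sqr_ge0 // exprn_even_gt0 //= mE oppr_eq0.
by rewrite -opprD oppr_eq0 gt_eqF.
Qed.

Lemma proj_semipos s (B : 'End(S)) : odd_operator B -> forall phi,
  '[phi, B (P s phi)] = '[P s phi, B (P s phi)].
Proof.
move=> oB phi; rewrite -{1}(proj_id (chi_proj s phi)) odd_proj //.
by rewrite -(form_proj s).
Qed.

(** Let u be the vector part of T = B P_s, whose form is positive except where P_s
    vanishes.  Positivity of traces gives g(u, x0) > 0.  By vec_sandwich the real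
    part of tr(x0 u T u) is g(u, x0) g(u, u), so u is timelike as soon as P_s u is
    not 0.  Otherwise u kills one chirality, and so both, because a vector z
    orthogonal to u anticommutes with u and exchanges the chiralities.  In dimension
    2 there is no such z, and null vectors do kill one chirality. *)
Lemma axis_future s (B : 'End(S)) : (2 < n)%N -> odd_operator B ->
  krein_positive (fform Y) B -> future_directed (axis (B \o P s)%VF).
Proof.
move=> n2 oB pB; have [b [x0 [tf x00 px0]]] := exists_time_frame n_gt0.
set T := (B \o P s)%VF; set u := vector_part T.
have TE phi : '[phi, T phi] = '[P s phi, B (P s phi)].
  by rewrite comp_lfunE proj_semipos.
have Tpos phi : P s phi != 0 -> 0 < '[phi, T phi] by rewrite TE => /pB.
have Tsp : semipos T.
  move=> phi; rewrite TE; have [->|/pB/ltW //] := eqVneq (P s phi) 0.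
  by rewrite form0l.
have [th th0] := fS_neq0 Y.
have x0_inj phi : v x0 phi = 0 -> phi = 0.
  case: tf => _ _ g0 _ e; have := vec_sqr x0 phi.
  by rewrite e linear0 g0 scale1r.
have [phi1 h1] : exists phi, P s phi != 0.
  have [e|] := eqVneq (P s th) 0; last by exists th.
  exists (v x0 th); apply: contra th0 => /eqP e'.
  have : P (~~ s) th = 0 by apply: x0_inj; rewrite odd_proj ?negbK //; apply: vec_odd.
  by have := chiral_proj_sum th; case: (s) e => /= -> + e2; rewrite e2 addr0 => <-.
have Rpos (z : R[i]) : 0 < z -> 0 < complex.Re z.
  by rewrite ltcE => /andP[].
have u0 : 0 < g u x0.
  by rewrite vector_partE /trace_pairing lftraceC; apply/Rpos/(trace_semipos tf px0 Tsp (Tpos _ h1)).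
have uT : semipos (v u \o T \o v u)%VF.
  by move=> phi; rewrite !comp_lfunE -vec_sa; move: (Tsp (v u phi)); rewrite comp_lfunE.
have [phi2 h2] : exists phi, P s (v u phi) != 0.
  apply/not_existsP => h; have {}h phi : P s (v u phi) = 0.
    by have /negP/negPn/eqP := h phi.
  have h' phi : v u (P (~~ s) phi) = 0 by rewrite odd_proj ?negbK //; apply: vec_odd.
  have [z [uz zz]] := exists_ortho u n2.
  (* z maps the other chirality onto this one and anticommutes with u. *)
  have h'' phi : v u (P s phi) = 0.
    have e : v z (v u (P s phi)) = 0.
      by rewrite vec_orthoC 1?metricC // odd_proj ?h' ?oppr0 //; exact: vec_odd.
    have := vec_sqr z (v u (P s phi)); rewrite e linear0 => /esym/eqP.
    by rewrite scaler_eq0 => /orP[/eqP/complexI e0|/eqP //]; rewrite e0 eqxx in zz.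
  have u_0 phi : v u phi = 0.
    rewrite -(chiral_proj_sum phi) linearD /=.
    by case: (s) h' h'' => /= h' h''; rewrite h' h'' addr0.
  have := vec_anticomm u x0 th; rewrite !u_0 linear0 oppr0 add0r => /esym/eqP.
  rewrite scaler_eq0 (negPf th0) orbF => /eqP/complexI/eqP.
  by rewrite mulrn_eq0 /= => /eqP e; rewrite e ltxx in u0.
have uu : 0 < g u u.
  have uTpos : 0 < '[phi2, (v u \o T \o v u)%VF phi2].
    by move: (Tpos _ h2); rewrite !comp_lfunE -vec_sa.
  have := Rpos _ (trace_semipos tf px0 uT uTpos).
  have -> : lftrace (v x0 \o (v u \o T \o v u))%VF =
      lftrace (T \o v ((g u x0 *+ 2) *: u - g u u *: x0))%VF.
    have -> : v ((g u x0 *+ 2) *: u - g u u *: x0) = (v u \o v x0 \o v u)%VF.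
      by apply/lfunP => psi; rewrite -vec_sandwich !comp_lfunE.
    by rewrite lftraceC -!comp_lfunA lftraceC -!comp_lfunA.
  rewrite -/(trace_pairing _ _) -vector_partE -/u metricDr -scaleNr !metricZr mulNr mulrnAl mulr2n.
  by rewrite [g u u * _]mulrC addrK pmulr_rgt0.
apply: timelike_axis => //; exact: krein_positive_from px0 uu u0.
Qed.

(** * Even elements in dimension two *)

(** In dimension 2 the chirality is a multiple of the product of the two frame
    vectors. *)
Lemma dim2_vec_even (x y : X) : n = 2%N ->
  exists a c, forall psi, v x (v y psi) = a *: psi + c *: chi psi.
Proof.
move=> n2; have [b pb chiE] := chi_prodE n_gt0; have fr := pseudo_orthonormal_frame pb.
have ub := pseudo_orthonormal_uniq pb; have sb := size_tuple b; rewrite [RHS]n2 in sb.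
have bb := pb.1.
have [p [q bE]] : exists p q, val b = [:: p; q].
  have sz2 (l : seq X) : size l = 2%N -> exists p q, l = [:: p; q].
    by case: l => [|p [|q []]] // _; exists p, q.
  exact: sz2.
have p0 : p \in val b by rewrite bE mem_head.
have q0 : q \in val b by rewrite bE inE mem_head orbT.
have pq : g p q = 0.
  by apply: fr.2 => //; move: ub; rewrite bE /= andbT inE.
have k0 : kappa != 0.
  have [psi p1] := fS_neq0 Y; apply: contra p1 => k0.
  have c0 : fchi Y = 0 by rewrite chiE; apply/eqP; rewrite scaler_eq0 k0.
  by rewrite -(chi_sqr psi) c0 !rho0.
have cE psi : v p (v q psi) = kappa^-1 *: chi psi.
  by rewrite chiE rhoZ scalerA mulVf // scale1r rho_prod bE.
move: x y; apply: (basis_vecP bb) => [y|c1 x1 x2 hx1 hx2 y|x xb].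
- by exists 0, 0 => psi; rewrite vec0 !zero_lfunE !scale0r addr0.
- have [a1 [d1 e1]] := hx1 y; have [a2 [d2 e2]] := hx2 y.
  exists (c1%:C * a1 + a2), (c1%:C * d1 + d2) => psi.
  by rewrite vecD vecZ !lfun_simp e1 e2 scalerDr !scalerA addrACA -!scalerDl.
apply: (basis_vecP bb) => [|c1 x1 x2 [a1 [d1 e1]] [a2 [d2 e2]]|y yb].
- by exists 0, 0 => psi; rewrite vec0 !zero_lfunE linear0 !scale0r addr0.
- exists (c1%:C * a1 + a2), (c1%:C * d1 + d2) => psi.
  rewrite vecD vecZ !lfun_simp linearD linearZ /= e1 e2 scalerDr !scalerA.
  by rewrite addrACA -!scalerDl.
move: xb yb; rewrite -![_ \in b]/(_ \in val b) bE !inE => /orP[]/eqP-> /orP[]/eqP->.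
- by exists (g p p)%:C, 0 => psi; rewrite vec_sqr scale0r addr0.
- by exists 0, kappa^-1 => psi; rewrite cE scale0r add0r.
- by exists 0, (- kappa^-1) => psi; rewrite vec_orthoC 1?metricC // cE scale0r add0r scaleNr.
by exists (g q q)%:C, 0 => psi; rewrite vec_sqr scale0r addr0.
Qed.

Lemma dim2_even_comm (T : 'End(S)) a : n = 2%N -> chi_commuting T ->
  clifford_even (fiota Y) a -> forall psi, T (rho a psi) = rho a (T psi).
Proof.
move=> n2 cT [s sE ->] psi; rewrite /word_sum; elim: s sE => [|w s IH] /=.
  by rewrite !big_nil !rho0 linear0.
case/andP => we /IH e; rewrite !big_cons !rhoD !rhoZ linearD linearZ /= e; congr (_ *: _ + _).
rewrite !rho_prod; move: w.2 we => t; have [m] := ubnP (size t).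
elim: m t => // m IHm [|x [|y t]] //= szm; rewrite negbK => te.
have [c [d h]] := dim2_vec_even x y n2.
by rewrite !h linearD !linearZ /= -cT IHm //; apply: ltnW.
Qed.

(** * Operators that differ by an even factor or by the antilinear structure *)

Lemma proj_neq0 s : exists phi, P s phi != 0.
Proof.
have [b [x0 [[_ _ g0 _] _ _]]] := exists_time_frame n_gt0; have [th th0] := fS_neq0 Y.
have [e|] := eqVneq (P s th) 0; last by exists th.
exists (v x0 th); apply: contra th0 => /eqP e'.
have e2 : P (~~ s) th = 0.
  have h : v x0 (P (~~ s) th) = 0 by rewrite odd_proj ?negbK //; exact: vec_odd.
  by have := vec_sqr x0 (P (~~ s) th); rewrite h linear0 g0 scale1r.
by have := chiral_proj_sum th; case: (s) e e2 => /= -> ->; rewrite addr0 => <-.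
Qed.

Lemma clifford_even_sandwich y (c : R[i]) a : clifford_even (fiota Y) a ->
  clifford_even (fiota Y) (c *: (fiota Y y * a * fiota Y y)).
Proof.
case=> s sE ->; exists [seq (c * w.1, y :: rcons w.2 y) | w <- s].
  rewrite all_map; apply: sub_all sE => w /=.
  by rewrite size_rcons /= negbK.
rewrite /word_sum big_map mulr_sumr mulr_suml scaler_sumr; apply: eq_bigr => w _ /=.
rewrite big_cons -cats1 big_cat /= big_seq1.
by rewrite -scalerAr -scalerAl scalerA !mulrA.
Qed.

Lemma clifford_even_word2 x y : clifford_even (fiota Y) (fiota Y x * fiota Y y).
Proof.
exists [:: (1, [:: x; y])] => //.
by rewrite /word_sum big_seq1 scale1r !big_cons big_nil mulr1.
Qed.

Lemma clifford_even0 : clifford_even (fiota Y) 0.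
Proof. by exists [::] => //; rewrite /word_sum big_nil. Qed.

(** The chirality to which J carries the chirality s. *)
Definition chirality_twist (s : bool) := if (n %% 8)%N \in [:: 0; 4]%N then ~~ s else s.

Lemma J_proj s psi : J (P s psi) = P (chirality_twist s) (J psi).
Proof.
rewrite !chiral_projE JZ [X in X *: _]conj_half JD JZ; congr (_ *: (_ + _)).
have -> : ((-1) ^+ s : R[i])^^* = (-1) ^+ s by rewrite rmorph_sign.
rewrite fJ_chi scalerA; congr (_ *: _); rewrite /chirality_twist /sgn_eps''.
by case: ifP => _; case: s => /=; rewrite ?expr0 ?expr1 ?mulr1 ?mul1r ?mulrNN ?mulr1.
Qed.

Lemma J_axis (T T' : 'End(S)) s : (forall psi, J (T psi) = - T' (J psi)) ->
  axis (T \o P s)%VF = axis (T' \o P (chirality_twist s))%VF.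
Proof.
move=> h; suff e : vector_part (T \o P s)%VF = vector_part (T' \o P (chirality_twist s))%VF by rewrite /axis e.
apply: metric_inj => x; rewrite !vector_partE /trace_pairing.
rewrite (@J_trace (T \o P s \o v x)%VF (T' \o P (chirality_twist s) \o v x)%VF).
  by case: (lftrace _).
by move=> psi; rewrite !(comp_lfunE, h, J_proj) fJ_vec !linearN opprK.
Qed.

(** On the spinors of one chirality the factor is a scalar, and it is positive
    because both forms are. *)
Lemma axis_proj_eq (T T' : 'End(S)) (l m : R[i]) s :
    krein_positive (fform Y) T -> krein_positive (fform Y) T' ->
    (forall psi, T' psi = T (l *: psi + m *: chi psi)) ->
  axis (T' \o P s)%VF = axis (T \o P s)%VF.
Proof.
move=> pT pT' h; pose k := l + (-1) ^+ s * m.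
have e : (T' \o P s)%VF = k *: (T \o P s)%VF.
  apply/lfunP => psi; rewrite scale_lfunE !comp_lfunE h chi_proj.
  by rewrite scalerA -scalerDl [m * _]mulrC linearZ.
have k0 : 0 < k.
  have [phi p0] := proj_neq0 s; have := pT' _ p0.
  have -> : T' (P s phi) = k *: T (P s phi).
    by have /lfunP/(_ phi) := e; rewrite scale_lfunE !comp_lfunE.
  by rewrite formZr pmulr_lgt0 ?pT // => /conj_gt0.
by rewrite e axisZ.
Qed.

End FibreTheory.

(** * Transport along Clifford isomorphisms *)

Section Transport.
Variables (R : realType) (n : nat) (kappa : R[i]) (Y Y' : spinor_fibre n kappa).
Variables (h : 'Hom(fS Y, fS Y')) (hK : lker h = 0%VS) (hf : limg h = fullv).
Variable L : {linear fX Y -> fX Y'}.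
Hypothesis hL : forall x psi, h (vec_op x psi) = vec_op (L x) (h psi).

Lemma clifford_isometry x : fg Y' (L x) (L x) = fg Y x x.
Proof.
have [psi p0] := fS_neq0 Y.
have hp0 : h psi != 0.
  by apply: contra p0; rewrite -memv_ker hK memv0.
have : h (vec_op x (vec_op x psi)) = vec_op (L x) (vec_op (L x) (h psi)) by rewrite !hL.
rewrite !vec_sqr linearZ => /eqP; rewrite eq_sym -subr_eq0 -scalerBl scaler_eq0 (negPf hp0) orbF subr_eq0 => /eqP.
by move/complexI.
Qed.

Lemma clifford_isometry2 x y : fg Y' (L x) (L y) = fg Y x y.
Proof.
have := clifford_isometry (x + y).
rewrite linearD !metricDl !metricDr !clifford_isometry (metricC (L y)) (metricC y).
by move=> e; lra.
Qed.

(** An isometry between nondegenerate spaces of the same dimension. *)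
Lemma clifford_surj z : exists x, z = L x.
Proof.
have [b pb] := fg_sig Y; have [b' pb'] := fg_sig Y'.
have k0 : lker (linfun L) == 0%VS.
  apply/lker0P => x y; rewrite !lfunE /= => e; apply: metric_inj => w.
  by rewrite -!clifford_isometry2 e.
have full : limg (linfun L) = fullv.
  apply/eqP; rewrite eqEdim subvf limg_dim_eq; last by rewrite (eqP k0) capv0.
  by rewrite (size_basis pb.1) (size_basis pb'.1) leqnn.
have /memv_imgP[x _ ->] : z \in limg (linfun L) by rewrite full memvf.
by exists x; rewrite lfunE.
Qed.

Lemma transport_axis (T : 'End(fS Y)) (T' : 'End(fS Y')) :
  (forall psi, T' (h psi) = h (T psi)) -> axis T' = L (axis T).
Proof.
move=> hT; have hV psi : h ((h^-1)%VF psi) = psi.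
  by apply: limg_lfunVK; rewrite hf memvf.
suff e : vector_part T' = L (vector_part T) by rewrite /axis e clifford_isometry linearZ.
apply: metric_inj => z; have [x ->] := clifford_surj z.
rewrite clifford_isometry2 !vector_partE /trace_pairing; congr (complex.Re _).
have -> : (T' \o vec_op (L x))%VF = (h \o ((T \o vec_op x) \o h^-1))%VF.
  by apply/lfunP => psi; rewrite !comp_lfunE -hT hL hV.
rewrite lftraceC -comp_lfunA; congr lftrace; apply/lfunP => psi.
by rewrite !comp_lfunE lker0_lfunK // hK.
Qed.

End Transport.

(** * Sections over darts *)

Section Global.
Variables (R : realType) (n : nat) (G : split_data R n).
Hypotheses (n_gt0 : (0 < n)%N) (n_even : ~~ odd n).
Hypotheses (hodd : gamma_odd G) (hmetric : metric G) (horient : orientation_preserving G).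

Local Notation V := (sV G).
Local Notation E := (sE G).
Local Notation X v := (fX (sfib v)).
Local Notation S v := (fS (sfib v)).
Local Notation ept := (endpoint (@ssrc _ _ G) (@stgt _ _ G)).
Local Notation form v := (fform (sfib v)).
Local Notation J v := (fJ (sfib v)).
Local Notation rho v := (frho (sfib v)).
Local Notation chi v := (rho v (fchi (sfib v))).
Local Notation K := (split_space G).
Local Notation sform := (@split_form R n G).

Local Notation h e := (@sh R n G e).

Lemma shK (e : E) : cancel (h e) ((h e)^-1)%VF.
Proof. by apply: lker0_lfunK; rewrite sh_inj. Qed.

Lemma shVK (e : E) : cancel ((h e)^-1)%VF (h e).
Proof. by move=> psi; apply: limg_lfunVK; rewrite sh_surj memvf. Qed.

Lemma hpm_lker0 (p : dart E) : lker (hpm p) == 0%VS.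
Proof.
case: p => e []; first by rewrite /= sh_inj.
by apply/lker0P; apply: (can_inj (g := h e)); exact: shVK.
Qed.

Lemma hpmK (p : dart E) : cancel (hpm p) ((hpm p)^-1)%VF.
Proof. exact: lker0_lfunK (hpm_lker0 p). Qed.

Lemma hpmVK (p : dart E) : cancel ((hpm p)^-1)%VF (hpm p).
Proof.
move=> psi; apply: limg_lfunVK; case: p psi => e [] psi; first by rewrite sh_surj memvf.
by rewrite -[psi]shK memv_img ?memvf.
Qed.

Lemma chi_hpmV (p : dart E) psi :
  chi (ept (opp_dart p)) ((hpm p)^-1%VF psi) = (hpm p)^-1%VF (chi (ept p) psi).
Proof. by rewrite -{2}(hpmVK psi) horient hpmK. Qed.

(** Polarization, with c = 1 and c = i. *)
Lemma metric2 (e : E) phi psi :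
  form (stgt e) (h e phi) (h e psi) = form (ssrc e) phi psi.
Proof.
move: hmetric => /(_ e) hm.
have q (c : R[i]) : c * form _ (h e phi) (h e psi) + conjc c * form _ (h e psi) (h e phi) =
    c * form _ phi psi + conjc c * form _ psi phi.
  have := hm (c *: phi + psi); rewrite linearD linearZ /= !formDl !formDr.
  rewrite !formZl !formZr !hm => /eqP; rewrite -subr_eq0 => e0.
  apply/eqP; rewrite -subr_eq0 -(eqP e0); apply/eqP; ring.
have conji : conjc (Complex 0 1) = - Complex 0 1 :> R[i].
  by apply/eqP; rewrite eq_complex /= oppr0 !eqxx.
have i0 : Complex 0 1 != 0 :> R[i] by rewrite eq_complex /= oner_eq0 andbF.
have := q 1; have := q (Complex 0 1); rewrite conji conjc1 !mul1r !mulNr -!mulrBr.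
move=> /(mulfI i0) e1 e2; have := congr2 (fun z1 z2 => 2^-1 * (z1 + z2)) e1 e2.
have two : 2 != 0 :> R[i] by rewrite pnatr_eq0.
have avg (a a' : R[i]) : 2^-1 * (a - a' + (a + a')) = a by field.
by rewrite !avg.
Qed.

Definition dart_section (p : dart E) (psi : S (ept p)) : K :=
  dfwith (fun q : dart E => 0 : S (ept q)) psi.

Lemma dart_section_in p psi : dart_section psi p = psi.
Proof. exact: dfwith_in. Qed.

Lemma dart_section_out p q (psi : S (ept p)) : p != q -> dart_section psi q = 0.
Proof. exact: dfwith_out. Qed.

Lemma opp_dart_inj : injective (@opp_dart E).
Proof. by move=> [e []] [f []] //= [->]. Qed.

Lemma split_formE (F F' : K) : sform F F' =
  \sum_(p : dart E) form (ept p) (F p) (hpm p (F' (opp_dart p))).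
Proof.
pose f e b := form (ept (e, b)) (F (e, b)) (hpm (e, b) (F' (opp_dart (e, b)))).
transitivity (\sum_(p : E * bool) f p.1 p.2); last by apply: eq_bigr => -[e b].
by rewrite -pair_bigA; apply: eq_bigr => e _; rewrite big_bool.
Qed.

Lemma form_dart_sectionl p phi (F : K) :
  sform (dart_section phi) F = form (ept p) phi (hpm p (F (opp_dart p))).
Proof.
rewrite split_formE (bigD1 p) //= dart_section_in big1 ?addr0 // => q qp.
by rewrite dart_section_out 1?eq_sym // form0l.
Qed.

Lemma form_dart_sectionr p (F : K) psi :
  sform F (@dart_section (opp_dart p) psi) = form (ept p) (F p) (hpm p psi).
Proof.
rewrite split_formE (bigD1 p) //= dart_section_in big1 ?addr0 // => q qp.
by rewrite dart_section_out ?(inj_eq opp_dart_inj) 1?eq_sym // linear0 form0r.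
Qed.

Lemma form_dart_section_opp p th phi :
  sform (@dart_section (opp_dart p) th) (@dart_section p phi) = form (ept p) (hpm p th) phi.
Proof.
case: p th phi => e [] th phi; rewrite form_dart_sectionl /=.
  by rewrite dart_section_in -[LHS]metric2 shVK.
by rewrite dart_section_in -[RHS]metric2 shVK.
Qed.

Lemma vertex_dart (v : V) : exists p : dart E, ept p = v.
Proof.
case: (sgraph G) => _ _ conn /card_gt0P[e0 _].
have /connectP[q] := conn v (ssrc e0).
case: q => [|w q] /=; first by move=> _ <-; exists (e0, false).
case/andP => /existsP[e /orP[]/andP[/eqP s1 /eqP s2]] _ _; first by exists (e, false).
by exists (e, true).
Qed.

(** The graph has no loop and at most one edge between two vertices. *)
Lemma dart_eq (p q : dart E) : ept p = ept q ->
  ept (opp_dart p) = ept (opp_dart q) -> p = q.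
Proof.
case: (sgraph G) => noloop simp _ _.
case: p q => e [] [f []] /= h1 h2.
- by rewrite (simp e f) // h1 h2.
- have ef : e = f by apply: simp; rewrite h1 h2 setUC.
  by move: h1; rewrite ef => h1; have := noloop f; rewrite h1 eqxx.
- have ef : e = f by apply: simp; rewrite h1 h2 setUC.
  by move: h1; rewrite ef => h1; have := noloop f; rewrite h1 eqxx.
by rewrite (simp e f) // h1 h2.
Qed.

Lemma ept_opp_neq (p : dart E) : ept p != ept (opp_dart p).
Proof.
by case: (sgraph G) => noloop _ _ _; case: p => e []; rewrite //= eq_sym.
Qed.

Definition vertex_section (v : V) (a : fCl (sfib v)) : forall w : V, fCl (sfib w) :=
  dfwith (fun w : V => 0 : fCl (sfib w)) a.

Lemma vertex_section_even v a : clifford_even (fiota (sfib v)) a ->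
  forall w, clifford_even (fiota (sfib w)) (@vertex_section v a w).
Proof.
by move=> ae w; rewrite /vertex_section; case: dfwithP => // w' _; exact: clifford_even0.
Qed.

Definition even_section (a : forall v : V, fCl (sfib v))
    (ae : forall v, clifford_even (fiota (sfib v)) (a v)) : even_sections G := exist _ a ae.

Definition even_vertex_section v a ae := even_section (@vertex_section_even v a ae).

(** The transports preserve chirality, so h_p b h_p^-1 commutes with chi for b
    even, and the blocks inherit the oddness of gamma. *)
Lemma one_form_blocks (beta : K -> K) : @one_form R (split_dirac G) beta ->
  exists B : forall p, 'End(S (ept p)), (forall p, odd_operator (B p)) /\
    forall F p, beta F p = B p (hpm p (F (opp_dart p))).
Proof.
case=> r hr.
suff [B [oB hB]] : exists B : forall p, 'End(S (ept p)), (forall p, odd_operator (B p)) /\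
    forall (F : K) p, (\sum_(ab <- r) split_rep ab.1 (split_dirac_op (split_rep ab.2 F) -
       split_rep ab.2 (split_dirac_op F)) : K) p = B p (hpm p (F (opp_dart p))).
  by exists B; split=> // F p; rewrite hr hB.
elim: r {hr} => [|[a b] r [B [oB hB]]].
  exists (fun p => 0); split=> [p psi|F p]; first by rewrite !zero_lfunE linear0 oppr0.
  by rewrite big_nil zero_lfunE.
pose c (p : dart E) : R[i] := ((if p.2 then -1 else 1) / sdelta p.1)%:C.
pose A p := (c p *: ((rho (ept p) (sval a (ept p)) \o (sgamma p \o (hpm p \o
    (rho (ept (opp_dart p)) (sval b (ept (opp_dart p))) \o (hpm p)^-1))))
  - (rho (ept p) (sval a (ept p)) \o (rho (ept p) (sval b (ept p)) \o sgamma p))))%VF.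
exists (fun p => A p + B p); split=> [p psi|F p].
  rewrite !add_lfunE oB [Z in _ = - Z]linearD /= opprD; congr (_ + _).
  have og := @hodd p.
  have ae := svalP a (ept p); have be := svalP b (ept p).
  have be' := svalP b (ept (opp_dart p)).
  rewrite /A !scale_lfunE linearZ /= -scalerN; congr (_ *: _).
  rewrite !add_lfunE !opp_lfunE !comp_lfunE -chi_hpmV -even_chiC // -horient og.
  rewrite !linearN og !linearN /= linearB /= !even_chiC //.
  by rewrite opprB opprK addrC.
rewrite big_cons add_lfunE -hB; congr (_ + _).
rewrite /A scale_lfunE add_lfunE opp_lfunE !comp_lfunE hpmK.
set b' := rho (ept p) (sval b (ept p)); set a' := rho (ept p) (sval a (ept p)).
set x := sgamma p (hpm p (F (opp_dart p))); set y := sgamma p _.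
have -> : split_rep a (split_dirac_op (split_rep b F) - split_rep b (split_dirac_op F)) p =
    a' (c p *: y - b' (c p *: x)) by [].
have -> : b' (c p *: x) = c p *: b' x by exact: linearZ.
by rewrite -scalerBr [LHS]linearZ /= -[a' y - a' _]linearB.
Qed.

(** * From a time-orientation form to a parallel vector field *)

Section FromTimeOrientation.
Variables (beta betaV : K -> K).
Hypothesis pto : @positive_time_orientation R (split_dirac G) beta betaV.
Hypothesis sst : @star_stable R (split_dirac G) beta betaV.
Hypothesis hspin : spin_preserving G.
Variable B : forall p : dart E, 'End(S (ept p)).
Hypothesis oB : forall p, odd_operator (B p).
Hypothesis betaE : forall F p, beta F p = B p (hpm p (F (opp_dart p))).

Lemma beta_dart_section p th : beta (@dart_section (opp_dart p) th) = dart_section (B p (hpm p th)).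
Proof.
apply: functional_extensionality_dep => q; rewrite betaE.
have [<-|pq] := eqVneq p q; first by rewrite !dart_section_in.
by rewrite !dart_section_out ?linear0 // ?linear0 // (inj_eq opp_dart_inj).
Qed.

Lemma block_sa p phi psi : form (ept p) (B p phi) psi = form (ept p) phi (B p psi).
Proof.
case: pto => _ sa _ _ _.
have := sa (@dart_section (opp_dart p) ((hpm p)^-1%VF phi)) (@dart_section (opp_dart p) ((hpm p)^-1%VF psi)).
rewrite !beta_dart_section /= form_dart_sectionr dart_section_in form_dart_section_opp !hpmVK; exact.
Qed.

Lemma block_positive p : krein_positive (form (ept p)) (B p).
Proof.
case: pto => _ _ _ [bK bVK] pos psi p0.
pose th := (hpm p)^-1%VF psi; pose F := @dart_section (opp_dart p) th.
have F0 : F != 0.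
  apply: contra p0 => /eqP/(congr1 (fun s : K => s (opp_dart p))).
  by rewrite /F dart_section_in -[psi]hpmVK -/th => ->; rewrite linear0.
have bF0 : beta F != 0.
  apply: contra F0 => /eqP e.
  have b0 : beta 0 = 0.
    by apply: functional_extensionality_dep => q; rewrite betaE !linear0.
  by apply/eqP; rewrite -[F]bK e; have := bK 0; rewrite b0.
have := pos _ bF0; rewrite bK /= beta_dart_section form_dart_sectionr dart_section_in hpmVK => h0.
by apply: conj_gt0; rewrite -formC.
Qed.

(** Tested on sections supported at one dart, the conjugation of the adjoint of a
    into b becomes an identity of blocks, with the same b at all darts. *)
Lemma block_star (a : even_sections G) : exists b : even_sections G,
  forall p phi psi, form (ept p) phi (rho (ept p) (sval a (ept p)) (B p psi)) =
    form (ept p) (rho (ept p) (sval b (ept p)) (B p phi)) psi.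
Proof.
case: pto => _ sa _ [bK bVK] _; case: sst => /(_ a)[aX [b [adj hb]]] _.
exists b => p phi psi.
pose F := @dart_section (opp_dart p) ((hpm p)^-1%VF phi).
pose F' := @dart_section (opp_dart p) ((hpm p)^-1%VF psi).
have e : sform (split_rep b (beta F)) F' = sform F (split_rep a (beta F')).
  have -> : split_rep b (beta F) = beta (aX F) by rewrite -[aX F]/(aX F) -{2}(bK F) hb.
  by rewrite [LHS]sa [LHS]adj.
have repd (c : even_sections G) x : split_rep c (@dart_section p x) = dart_section (rho (ept p) (sval c (ept p)) x).
  apply: functional_extensionality_dep => q; rewrite /split_rep.
  by have [<-|pq] := eqVneq p q; rewrite ?dart_section_in ?dart_section_out ?linear0.
by move: e; rewrite !beta_dart_section !repd form_dart_sectionr dart_section_in form_dart_section_opp !hpmVK.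
Qed.

Lemma block_J e psi :
  J (stgt e) ((h e \o B (e, false) \o (h e)^-1)%VF psi) = - B (e, true) (J (stgt e) psi).
Proof.
case: pto => _ _ hJ _ _.
have := hJ (@dart_section (e, true) psi) => /(congr1 (fun s : K => s (e, true))).
rewrite -[LHS]/(h e (J (ssrc e) (beta (@dart_section (e, true) psi) (e, false)))) betaE dart_section_in /=.
rewrite -[RHS]/(- beta (split_J (@dart_section (e, true) psi)) (e, true)) betaE.
rewrite -[split_J _ _]/((h e)^-1%VF (J (stgt e) (@dart_section (e, true) psi (e, true)))) dart_section_in /= shVK.
by rewrite (hspin (p := (e, true))) !comp_lfunE.
Qed.

(** The endpoints of two darts may be the same vertex without being convertible;
    this predicate collects the blocks at a vertex without casts. *)
Inductive block_at : forall v : V, 'End(S v) -> Prop :=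
  BlockAt p : block_at (B p).

Lemma block_atP (v : V) (T : 'End(S v)) : block_at T ->
  [/\ odd_operator T, krein_positive (form v) T & krein_selfadjoint (form v) T].
Proof. by case=> p; split; [exact: oB|exact: block_positive|exact: block_sa]. Qed.

(** Both blocks carry every even word to the same even element, so T^-1 T'
    commutes with the even algebra. *)
Lemma block_at_ratio (v : V) (T T' : 'End(S v)) : block_at T -> block_at T' ->
  exists l m, forall psi, T' psi = T (l *: psi + m *: chi v psi).
Proof.
move=> bT bT'; have [_ pT sT] := block_atP bT; have [_ _ sT'] := block_atP bT'.
have kT : lker T == 0%VS.
  apply/lker0P => x y e; have d : T (x - y) = 0 by rewrite linearB /= e subrr.
  by apply/eqP; rewrite -subr_eq0; apply/negPn/negP => /pT; rewrite d form0r ltxx.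
pose C := (T^-1 \o T')%VF.
have TC psi : T (C psi) = T' psi by rewrite comp_lfunE lker0_lfunVK.
have key x y : exists b : fCl (sfib v), forall U : 'End(S v), block_at U ->
    forall psi, U (vec_op x (vec_op y psi)) = rho v b (U psi).
  have [b hb] := block_star (even_vertex_section (clifford_even_word2 y x)).
  exists (sval b v) => U bU psi; have [_ _ sU] := block_atP bU.
  apply: form_eqP => th; rewrite sU !vec_sa -!rho_vecM.
  have hb' : forall v' (U' : 'End(S v')), block_at U' -> forall phi psi,
    form v' phi (rho v' (vertex_section (fiota (sfib v) y * fiota (sfib v) x) v') (U' psi)) =
    form v' (rho v' (sval b v') (U' phi)) psi.
    by move=> v' U' [p] phi psi'; exact: hb.
  have := hb' _ _ bU psi th; rewrite /vertex_section dfwith_in rho_vecM; exact.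
have [|l [m hC]] := @even_commutant _ _ _ (sfib v) n_gt0 n_even C.
  move=> x y psi; have [b hb] := key x y.
  move/lker0P: (kT); apply.
  by rewrite TC !hb // TC.
by exists l, m => psi; rewrite -hC TC.
Qed.

(** J may exchange the two chiralities along an edge, hence the symmetric sum. *)
Definition block_vector (v : V) (T : 'End(S v)) : X v :=
  axis (Y := sfib v) (T \o chiral_proj (sfib v) false)%VF +
  axis (Y := sfib v) (T \o chiral_proj (sfib v) true)%VF.

Lemma block_vector_uniq (v : V) (T T' : 'End(S v)) : block_at T -> block_at T' ->
  block_vector T' = block_vector T.
Proof.
move=> bT bT'; have [l [m e]] := block_at_ratio bT bT'.
have [_ pT _] := block_atP bT; have [_ pT' _] := block_atP bT'.
by rewrite /block_vector !(axis_proj_eq n_gt0 n_even _ pT pT' e).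
Qed.

Lemma block_vector_transport e (L : {linear X (ssrc e) -> X (stgt e)}) :
  (forall x psi, h e (vec_op x psi) = vec_op (L x) (h e psi)) ->
  L (block_vector (B (e, false))) = block_vector (B (e, true)).
Proof.
move=> hL; have hK := sh_inj (s := G) e; have hf := sh_surj (s := G) e.
pose T' := (h e \o B (e, false) \o (h e)^-1)%VF.
have hproj s psi : h e (chiral_proj (sfib (ssrc e)) s psi) =
    chiral_proj (sfib (stgt e)) s (h e psi).
  rewrite !chiral_projE linearZ linearD linearZ /=.
  by rewrite -(horient (p := (e, true))).
have tr s : L (axis (Y := sfib (ssrc e)) (B (e, false) \o chiral_proj (sfib (ssrc e)) s)%VF) =
    axis (Y := sfib (stgt e)) (B (e, true) \o chiral_proj (sfib (stgt e)) (chirality_twist n s))%VF.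
  rewrite -(J_axis (T := T')); last exact: block_J.
  symmetry; apply: (transport_axis hK hf hL) => psi.
  by rewrite !comp_lfunE -hproj shK.
rewrite linearD !tr /block_vector /chirality_twist; case: ifP => _ //=.
by rewrite addrC.
Qed.

Lemma parallel_of_edges (u : forall v : V, X v) :
  (forall e psi, h e (vec_op (u (ssrc e)) psi) = vec_op (u (stgt e)) (h e psi)) ->
  parallel u.
Proof.
move=> hu v w Q.
have hp (p : dart E) psi : hpm p (vec_op (u (ept (opp_dart p))) psi) =
    vec_op (u (ept p)) (hpm p psi).
  case: p psi => e [] psi; first exact: hu.
  by apply: (can_inj (@shK e)); rewrite hu /= !shVK.
have hol psi : holonomy Q (vec_op (u v) psi) = vec_op (u w) (holonomy Q psi).
  by elim: Q psi => [v' psi|p w' Q IH psi] /=; rewrite ?id_lfunE // !comp_lfunE hp IH.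
have Qinj : lker (holonomy Q) == 0%VS /\ limg (holonomy Q) = fullv.
  elim: Q {hol} => [v'|p w' Q [IH1 IH2]] /=.
    by split; [apply/lker0P => x y; rewrite !id_lfunE|rewrite lim1g].
  move/lker0P: IH1 => inj1; move/lker0P: (hpm_lker0 p) => inj2.
  split; first by apply/lker0P => x y; rewrite !comp_lfunE => /inj1/inj2.
  rewrite limg_comp; suff -> : limg (hpm p) = fullv by [].
  apply/vspaceP => x; rewrite memvf; apply/memv_imgP.
  by exists ((hpm p)^-1%VF x); rewrite ?memvf // hpmVK.
apply/lfunP => psi; rewrite !comp_lfunE -[vec (u v)]/(vec_op (u v)) hol.
by rewrite limg_lfunVK // Qinj.2 memvf.
Qed.

Lemma parallel_future_vector : (2 < n)%N -> clifford_connection G ->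
  exists u : forall v : V, X v, (forall v, future_directed (u v)) /\ parallel u.
Proof.
move=> n2 cliff.
have exT v : exists T : 'End(S v), block_at T.
  by have [p <-] := vertex_dart v; exists (B p).
pose T v := projT1 (cid (exT v)); have bT v : block_at (T v) := projT2 (cid (exT v)).
exists (fun v => block_vector (T v)); split=> [v|].
  have [oT pT _] := block_atP (bT v).
  by apply: future_add => //; apply: axis_future.
apply: parallel_of_edges => e psi; have [L hL] := cliff e.
have hL' x th : h e (vec_op x th) = vec_op (L x) (h e th).
  by have /lfunP/(_ th) := hL x; rewrite !comp_lfunE.
rewrite hL'.
rewrite -(block_vector_uniq (bT (ssrc e)) (BlockAt (e, false))).
rewrite -(block_vector_uniq (bT (stgt e)) (BlockAt (e, true))).
by rewrite (block_vector_transport hL').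
Qed.

End FromTimeOrientation.

(** * One-forms with prescribed blocks *)

Lemma rep_faithful (a b : even_sections G) :
  (forall F : K, split_rep a F = split_rep b F) -> a = b.
Proof.
move=> hab; case: a b hab => [a ae] [b be] hab.
have e : a = b.
  apply: functional_extensionality_dep => v; have [p <-] := vertex_dart v.
  apply: (rho_inj n_gt0 n_even) => psi.
  have := congr1 (fun s : K => s p) (hab (dart_section psi)).
  by rewrite /split_rep /= dart_section_in.
by move: ae be hab; rewrite e => ae be _; congr exist; exact: Prop_irrelevance.
Qed.

Local Notation one_form := (@one_form R (split_dirac G)).

Lemma one_form_ext (f1 f2 : K -> K) : (forall F, f1 F = f2 F) -> one_form f1 -> one_form f2.
Proof. by move=> e [r hr]; exists r => F; rewrite -e hr. Qed.

Lemma one_form_sum (I : eqType) (r : seq I) (f : I -> K -> K) :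
  {in r, forall i, one_form (f i)} -> one_form (fun F => \sum_(i <- r) f i F).
Proof.
elim: r => [|i r IH] h; first by exists [::] => F; rewrite !big_nil.
have [r1 h1] := h i (mem_head _ _).
have [j jr|r2 h2] := IH; first by apply: h; rewrite inE jr orbT.
by exists (r1 ++ r2) => F; rewrite big_cons big_cat /= -h1 -h2.
Qed.

(** With a supported at one end of the edge and b at the other end, a D b vanishes
    outside the dart p, and a b = 0. *)
Lemma one_form_single (p : dart E) (A C : 'End(S (ept p))) :
  chi_commuting A -> chi_commuting C ->
  one_form (fun F => @dart_section p (A (sgamma p (C (hpm p (F (opp_dart p))))))).
Proof.
move=> cA cC.
pose c (q : dart E) : R[i] := ((if q.2 then -1 else 1) / sdelta q.1)%:C.
have c0 : c p != 0.
  apply/eqP => /complexI/eqP; rewrite mulf_eq0 invr_eq0 (gt_eqF (sdelta_gt0 _)) orbF.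
  by case: ifP; rewrite ?oppr_eq0 oner_eq0.
(* The factor 1 / c p compensates the coefficient of the Dirac operator, and b is
   C transported to the other end. *)
have [|a ae aE] := @chiC_even _ _ _ _ n_gt0 n_even ((c p)^-1 *: A).
  by move=> psi; rewrite !scale_lfunE linearZ /= cA.
have [|b be bE] := @chiC_even _ _ _ _ n_gt0 n_even ((hpm p)^-1 \o (C \o hpm p))%VF.
  by move=> psi; rewrite !comp_lfunE chi_hpmV cC horient.
pose sa := even_vertex_section ae; pose sb := even_vertex_section be.
exists [:: (sa, sb)] => F; rewrite big_seq1; apply: functional_extensionality_dep => q.
rewrite -[RHS]/(rho (ept q) (vertex_section a (ept q)) (c q *: sgamma q (hpm q
    (rho (ept (opp_dart q)) (vertex_section b (ept (opp_dart q))) (F (opp_dart q))))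
  - rho (ept q) (vertex_section b (ept q)) (c q *: sgamma q (hpm q (F (opp_dart q)))))).
have sub_0 (U : vectType R[i]) (f : 'End(U)) z z' : z' = 0 -> f (z - z') = f z.
  by move=> ->; rewrite subr0.
have [<-|pq] := eqVneq p q.
  rewrite dart_section_in /vertex_section !dfwith_in dfwith_out 1?eq_sym ?ept_opp_neq //.
  rewrite sub_0; last exact: rho0.
  rewrite aE bE scale_lfunE [in RHS]linearZ scalerA mulVf // scale1r.
  by rewrite !comp_lfunE hpmVK.
rewrite dart_section_out //.
have [e|ne] := eqVneq (ept p) (ept q); last by rewrite /vertex_section dfwith_out // rho0.
have ne1 : ept (opp_dart p) != ept (opp_dart q).
  by apply: contra pq => /eqP e'; apply/eqP/dart_eq.
have ne2 : ept (opp_dart p) != ept q by rewrite -e eq_sym ept_opp_neq.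
rewrite /vertex_section sub_0; last by rewrite (dfwith_out _ _ ne2) rho0.
by rewrite (dfwith_out _ _ ne1) rho0 !linear0.
Qed.

Hypothesis hnv : gamma_nonvanishing G.

Lemma one_form_of_blocks (B : forall p : dart E, 'End(S (ept p))) :
  (forall p, odd_operator (B p)) ->
  one_form (fun F p => B p (hpm p (F (opp_dart p)))).
Proof.
move=> oB.
apply: (@one_form_ext (fun F => \sum_p dart_section (B p (hpm p (F (opp_dart p)))))).
  move=> F; apply: functional_extensionality_dep => q.
  have -> : (\sum_p dart_section (B p (hpm p (F (opp_dart p)))) : K) q =
      \sum_p dart_section (B p (hpm p (F (opp_dart p)))) q.
    by elim/big_rec2: _ => // p x y _ <-.
  rewrite (bigD1 q) //= dart_section_in big1 ?addr0 // => p pq; exact: dart_section_out.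
apply: one_form_sum => p _.
have [r [hr hB]] := odd_bimodule (@hodd p) (oB p) (hnv p).1 (hnv p).2.
apply: (@one_form_ext (fun F => \sum_(w <- r) dart_section (w.1 (sgamma p (w.2 (hpm p (F (opp_dart p)))))))).
  move=> F; apply: functional_extensionality_dep => q; rewrite hB.
  have -> : (\sum_(w <- r) dart_section (w.1 (sgamma p (w.2 (hpm p (F (opp_dart p)))))) : K) q =
      \sum_(w <- r) dart_section (w.1 (sgamma p (w.2 (hpm p (F (opp_dart p)))))) q.
    by elim/big_rec2: _ => // w x y _ <-.
  have [<-|pq] := eqVneq p q.
    by rewrite dart_section_in; apply: eq_bigr => w _; rewrite dart_section_in.
  by rewrite dart_section_out // big1 // => w _; rewrite dart_section_out.
apply: one_form_sum => w wr; have [h1 h2] := hr w wr; exact: one_form_single.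
Qed.

Hypothesis hspin : spin_preserving G.

(** * From vectors to a time-orientation form *)

Section FromVectors.
Variables (x : forall e : E, X (stgt e)) (y : forall v : V, X v).
Hypothesis x_future : forall e, future_directed (x e).
Hypothesis y_nonnull : forall v, fg (sfib v) (y v) (y v) != 0.

(** The block at the source of an edge is the transport of the block at its
    target: anticommutation with J forces this when one of them is a vector. *)
Definition vec_block (z : forall e : E, X (stgt e)) (p : dart E) : 'End(S (ept p)) :=
  match p return 'End(S (ept p)) with
  | (e, true) => vec_op (z e)
  | (e, false) => ((h e)^-1 \o (vec_op (z e) \o h e))%VF
  end.

Hypothesis y_comm : forall (p : dart E) a, clifford_even (fiota (sfib (ept p))) a ->
  forall psi, vec_op (y (ept p)) (vec_block x p (rho (ept p) a psi)) =
    rho (ept p) a (vec_op (y (ept p)) (vec_block x p psi)).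

Let gx e := fg (sfib (stgt e)) (x e) (x e).
Let xV e := (gx e)^-1 *: x e.

Lemma gx_gt0 e : 0 < gx e. Proof. by case: (x_future e). Qed.

Lemma xVK e psi : vec_op (x e) (vec_op (xV e) psi) = psi.
Proof.
rewrite /xV vecZ scale_lfunE linearZ /= vec_sqr scalerA -rmorphM /= mulVf ?scale1r //.
by rewrite gt_eqF ?gx_gt0.
Qed.

Lemma xKV e psi : vec_op (xV e) (vec_op (x e) psi) = psi.
Proof.
rewrite /xV vecZ scale_lfunE vec_sqr scalerA -rmorphM /= mulVf ?scale1r //.
by rewrite gt_eqF ?gx_gt0.
Qed.

Lemma blockK p psi : vec_block x p (vec_block xV p psi) = psi.
Proof.
case: p psi => e [] psi; first exact: xVK.
by rewrite /= !comp_lfunE shVK xVK shK.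
Qed.

Lemma block_odd p : odd_operator (vec_block x p).
Proof.
case: p => e [] psi; first exact: vec_odd.
rewrite /= !comp_lfunE.
have c1 := @horient (e, true); have c2 := @chi_hpmV (e, true).
rewrite /= in c1 c2; rewrite -c1 (vec_odd n_gt0 n_even) linearN /= c2.
by [].
Qed.

Definition dir_form (F : K) : K := fun p => vec_block x p (hpm p (F (opp_dart p))).
Definition dir_formV (F : K) : K :=
  fun p => hpm p (vec_block xV (opp_dart p) (F (opp_dart p))).

Lemma dir_formK : cancel dir_form dir_formV.
Proof.
move=> F; apply: functional_extensionality_dep => -[e []];
  by rewrite /dir_formV /dir_form /= ?comp_lfunE ?shVK ?xKV ?shVK ?shK.
Qed.

Lemma dir_formVK : cancel dir_formV dir_form.
Proof.
move=> F; apply: functional_extensionality_dep => -[e []];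
  by rewrite /dir_formV /dir_form /= ?comp_lfunE ?shVK ?shK ?xVK ?shVK ?shK.
Qed.

Lemma dir_form_sa : krein_selfadjoint sform dir_form.
Proof.
move=> F F'; rewrite /split_form; apply: eq_bigr => e _; rewrite addrC; congr (_ + _).
  by rewrite /dir_form /= !comp_lfunE shVK -[LHS]metric2 !shVK vec_sa.
by rewrite /dir_form /= vec_sa -[RHS]metric2 !shVK.
Qed.

Lemma dir_form_positive : krein_positive sform dir_formV.
Proof.
move=> F F0.
have E e : form (stgt e) (F (e, true)) (hpm (e, true) (dir_formV F (e, false))) +
    form (ssrc e) (F (e, false)) (hpm (e, false) (dir_formV F (e, true))) =
    form (stgt e) (F (e, true)) (vec_op (xV e) (F (e, true))) +
    form (stgt e) (h e (F (e, false))) (vec_op (xV e) (h e (F (e, false)))).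
  by rewrite /dir_formV /= shVK comp_lfunE shK comp_lfunE -[Z in _ + Z]metric2 shVK.
have pos e psi : psi != 0 -> 0 < form (stgt e) psi (vec_op (xV e) psi).
  case: (future_scale (a := (gx e)^-1) _ (x_future e)) => [|_]; last by apply.
  by rewrite invr_gt0 gx_gt0.
have nn e psi : 0 <= form (stgt e) psi (vec_op (xV e) psi).
  by have [->|/pos/ltW //] := eqVneq psi 0; rewrite form0l.
have [p Fp] : exists p, F p != 0.
  apply/not_existsP => h0; move/eqP: F0; apply; apply: functional_extensionality_dep => p.
  by have /negP/negPn/eqP := h0 p.
rewrite /split_form (eq_bigr _ (fun e _ => E e)) (bigD1 p.1) //=.
apply: ltr_wpDr; first by apply: sumr_ge0 => e _; rewrite addr_ge0.
case: p Fp => e [] Fp /=; first by rewrite ltr_wpDr ?pos.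
rewrite ltr_wpDl ?pos //; apply: contra Fp => /eqP e0.
by rewrite -(shK (F (e, false))) e0 linear0.
Qed.

Lemma dir_form_J : conjugates_to (@split_J R n G) dir_form (fun F => - dir_form F).
Proof.
move=> F; apply: functional_extensionality_dep => -[e b].
have s1 := @hspin (e, true); rewrite /= in s1.
case: b.
  rewrite -[RHS]/(- dir_form (split_J F) (e, true)) /split_J /dir_form /= !comp_lfunE.
  by rewrite s1 !shVK fJ_vec.
rewrite -[RHS]/(- dir_form (split_J F) (e, false)) /split_J /dir_form /= !comp_lfunE.
by rewrite fJ_vec linearN shVK s1.
Qed.

Lemma shVV e psi : ((h e)^-1)^-1%VF psi = h e psi.
Proof. by have k := @hpmK (e, false); rewrite /= in k; rewrite -[RHS]k shK. Qed.

(** At every dart y B_p commutes with the even a', hence B_p a' B_p^-1 is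
    y^-1 a' y, which depends only on the endpoint. *)
Lemma dir_form_star (a a' : even_sections G) (c : even_sections G) :
  (forall v, adjoint_of (form v) (rho v (sval a v)) (rho v (sval a' v))) ->
  (forall v, sval c v = (fg (sfib v) (y v) (y v))^-1%:C *:
     (fiota (sfib v) (y v) * sval a' v * fiota (sfib v) (y v))) ->
  exists aX : K -> K, adjoint_of sform (split_rep a) aX /\
    forall F, dir_form (aX (dir_formV F)) = split_rep c F.
Proof.
move=> adj hc.
exists (fun F p => hpm p (rho _ (sval a' (ept (opp_dart p))) ((hpm p)^-1%VF (F p)))); split.
  move=> F F'; rewrite /split_form; apply: eq_bigr => e _; congr (_ + _).
    by rewrite /= metric2 adj -[LHS]metric2 shVK.
  by rewrite /= -[LHS]metric2 !shVK adj shVV -[RHS]metric2 shVK.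
move=> F; apply: functional_extensionality_dep => p.
have -> : dir_form (fun p0 => hpm p0 (rho _ (sval a' (ept (opp_dart p0)))
    ((hpm p0)^-1%VF (dir_formV F p0)))) p =
    vec_block x p (rho (ept p) (sval a' (ept p)) (vec_block xV p (F p))).
  case: p => e [].
    rewrite /dir_form /dir_formV /= shVK; congr (vec_op _ (rho _ _ _)).
    by rewrite shVV shVK.
  by rewrite /dir_form /dir_formV /= shK shK.
set v := ept p; set T := vec_block x p; set TV := vec_block xV p.
have e1 psi : vec_op (y v) (T (rho v (sval a' v) (TV psi))) =
    rho v (sval a' v) (vec_op (y v) psi).
  by rewrite y_comm; [rewrite /T blockK|exact: (svalP a')].
rewrite /split_rep hc rhoZ !rhoM -[rho v (fiota _ _)]/(vec_op (y v)) -e1 vec_sqr scalerA.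
by rewrite -rmorphM /= mulVf ?scale1r.
Qed.

Lemma reconstructible_of_vectors : reconstructible (split_dirac G).
Proof.
split; first exact: rep_faithful.
exists dir_form, dir_formV; split.
  split; [|exact: dir_form_sa|exact: dir_form_J| |exact: dir_form_positive].
    by apply: one_form_of_blocks => p; exact: block_odd.
  by split; [exact: dir_formK|exact: dir_formVK].
pose k v := (fg (sfib v) (y v) (y v))^-1%:C.
have k0 v : (fg (sfib v) (y v) (y v))%:C != 0.
  by apply/eqP => /complexI/eqP; rewrite (negPf (y_nonnull v)).
pose sandwich (a : even_sections G) : even_sections G :=
  even_section (a := fun v => k v *: (fiota (sfib v) (y v) * sval a v * fiota (sfib v) (y v)))
    (fun v => clifford_even_sandwich (y v) (k v) (svalP a v)).
have adjS (a : even_sections G) : exists a' : even_sections G,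
    forall v, adjoint_of (form v) (rho v (sval a v)) (rho v (sval a' v)).
  pose ex v := rho_adjoint (Y := sfib v) (sval a v).
  pose a' v := projT1 (cid (ex v)).
  have h1 v := projT2 (cid (ex v)).
  by exists (even_section (a := a') (fun v => (h1 v).2 (svalP a v))) => v; case: (h1 v).
split=> [a|c].
  have [a' adj] := adjS a.
  have [aX [h1 h2]] := @dir_form_star a a' (sandwich a') adj (fun v => erefl).
  by exists aX, (sandwich a').
have [a adj] := adjS (sandwich c).
have adj' v : adjoint_of (form v) (rho v (sval a v)) (rho v (sval (sandwich c) v)).
  exact: adjoint_sym.
have [|aX [h1 h2]] := @dir_form_star a (sandwich c) c adj' _; last by exists a, aX.
move=> v /=; rewrite -/(k v) -scalerAr -scalerAl scalerA.
set i := fiota _ _; set d := (fg (sfib v) (y v) (y v))%:C.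
have -> : i * (i * sval c v * i) * i = (i * i) * sval c v * (i * i) by rewrite !mulrA.
rewrite iota_sqr -/d -scalerAl mul1r -scalerAr mulr1 !scalerA.
have -> : k v * k v * d * d = 1; last by rewrite scale1r.
have kd : k v * d = 1 by rewrite /k /d -rmorphM /= mulVf.
by rewrite -mulrA mulrACA kd mulr1.
Qed.

End FromVectors.

(** The operator y B_p is even, and the even algebra is commutative. *)
Lemma reconstructible_dim2 : n = 2%N -> reconstructible (split_dirac G).
Proof.
move=> n2.
have ex (v : V) : exists z : X v, krein_positive (form v) (vec_op z).
  by have [b [z [_ _ pz]]] := exists_time_frame (sfib v) n_gt0; exists z.
pose y (v : V) := projT1 (cid (ex v)); have py (v : V) := projT2 (cid (ex v)).
have fut (v : V) : future_directed (y v) by apply: krein_positive_future; exact: py.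
pose x (e : E) := y (stgt e).
apply: (@reconstructible_of_vectors x y) => [e|v|p a ae psi].
- exact: fut.
- by rewrite gt_eqF //; case: (fut v).
have cT : chi_commuting (vec_op (y (ept p)) \o vec_block x p)%VF.
  move=> th; rewrite !comp_lfunE (block_odd x) linearN /=.
  by rewrite (chi_vec n_gt0 n_even).
by have := dim2_even_comm n_gt0 n2 cT ae psi; rewrite !comp_lfunE.
Qed.

Lemma reconstructible_of_parallel (u : forall v : V, X v) :
  (forall v, future_directed (u v)) -> parallel u -> reconstructible (split_dirac G).
Proof.
move=> fut par.
apply: (@reconstructible_of_vectors (fun e => u (stgt e)) u) => [e|v|p a ae psi].
- exact: fut.
- by rewrite gt_eqF //; case: (fut v).
have B th : vec_block (fun e => u (stgt e)) p th = vec_op (u (ept p)) th.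
  case: p {a ae psi} th => e [] th //=.
  have /lfunP := par _ _ (walk_cons (p := (e, true)) (walk_nil (G := G) (stgt e))).
  move/(_ (h e th)); rewrite !comp_lfunE /= => e1.
  have c1 : (\1 \o h e)%VF = h e by rewrite comp_lfun1l.
  move: e1; rewrite c1 shK => e1.
  by rewrite id_lfunE in e1; rewrite -[RHS]shK; congr ((_)^-1%VF _).
by rewrite !B !vec_sqr linearZ.
Qed.

End Global.

(** * Reconstructibility of split Dirac structures *)

Theorem theorem2 (R : realType) (n : nat) (hn : (2 <= n)%N) (hn_even : ~~ odd n)
    (G : split_data R n)
    (hsa : gamma_selfadjoint G) (hodd : gamma_odd G) (hJ : gamma_J G)
    (hnv : gamma_nonvanishing G)
    (hmetric : metric G) (hspin : spin_preserving G)
    (horient : orientation_preserving G) :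
  (n = 2%N -> reconstructible (split_dirac G)) /\
  ((2 < n)%N -> clifford_connection G ->
    (reconstructible (split_dirac G) <->
     exists u : forall v : sV G, fX (sfib v),
       (forall v, future_directed (u v)) /\ parallel u)).
Proof.
have n0 : (0 < n)%N by apply: leq_trans hn.
split; first exact: reconstructible_dim2.
move=> n2 cliff; split=> [[_ [beta [betaV [pto sst]]]]|[u [fut par]]].
  have [oneF _ _ _ _] := pto.
  have [B [oB hB]] := one_form_blocks n0 hn_even hodd horient oneF.
  exact: (parallel_future_vector n0 hn_even hmetric horient pto sst hspin oB hB).
exact: reconstructible_of_parallel par.
Qed.
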